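(* Let $\Lambda_\infty=(r_0=0,r_1,r_2,\dots)$ be strictly increasing with $\lim_{n\to\infty}r_n=\infty$ and $\sum_{i=1}^\infty 1/r_i=\infty$, and let $0<a<1$. Then for every fixed positive integer $k$, $$\lim_{m\to\infty}\ \max_{0\le i\le m}\Bigl|\eta_i(t^{r_1},\Lambda_m,[a,1])^{r_k/r_1}-\eta_i(t^{r_k},\Lambda_m,[a,1])\Bigr|=0 .$$
   Context: For a sequence $0=r_0<r_1<r_2<\cdots$ of reals, write $\Lambda_n=(r_0,\dots,r_n)$ and $E(\Lambda_n)=\mathrm{span}(t^{r_0}=1,t^{r_1},\dots,t^{r_n})$ (functions on $]0,\infty[$). For an interval $[a,b]$ with $0<a<b$, the Chebyshev–Bernstein basis $(B^n_{0,\Lambda_n},\dots,B^n_{n,\Lambda_n})$ of $E(\Lambda_n)$ over $[a,b]$ is the unique basis of $E(\Lambda_n)$ with $\sum_{k=0}^n B^n_{k,\Lambda_n}\equiv 1$ such that, for each $k$, $B^n_{k,\Lambda_n}$ has a zero of multiplicity (exactly) $k$ at $a$ and of multiplicity $n-k$ at $b$. For $P\in E(\Lambda_n)$ and $m\ge n$, the control points $\eta_i(P,\Lambda_m,[a,b])$, $i=0,\dots,m$, are defined by $P(t)=\sum_{i=0}^m B^m_{i,\Lambda_m}(t)\,\eta_i(P,\Lambda_m,[a,b])$. *)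

(* Defs.v *)
From Stdlib Require Import Reals Lra List.
Import ListNotations.
Open Scope R_scope.

Definition in_E (r : nat -> R) (n : nat) (f : R -> R) : Prop :=
  exists c : nat -> R, forall t, 0 < t ->
    f t = sum_f_R0 (fun j => c j * Rpower t (r j)) n.

Inductive nth_derive : nat -> (R -> R) -> (R -> R) -> Prop :=
| nd0 (f : R -> R) : nth_derive 0 f f
| ndS (n : nat) (f g h : R -> R) :
    (forall t, 0 < t -> derivable_pt_lim f t (g t)) ->
    nth_derive n g h -> nth_derive (S n) f h.

Definition zero_mult (f : R -> R) (x : R) (k : nat) : Prop :=
  (forall (j : nat) (h : R -> R), (j < k)%nat -> nth_derive j f h -> h x = 0) /\
  (exists h, nth_derive k f h /\ h x <> 0).

Definition is_CB_basis (r : nat -> R) (m : nat) (a b : R) (Bm : nat -> R -> R) : Prop :=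
  (forall i, (i <= m)%nat -> in_E r m (Bm i)) /\
  (forall lam : nat -> R,
     (forall t, 0 < t -> sum_f_R0 (fun i => lam i * Bm i t) m = 0) ->
     forall i, (i <= m)%nat -> lam i = 0) /\
  (forall f, in_E r m f -> exists lam : nat -> R,
     forall t, 0 < t -> f t = sum_f_R0 (fun i => lam i * Bm i t) m) /\
  (forall t, 0 < t -> sum_f_R0 (fun i => Bm i t) m = 1) /\
  (forall i, (i <= m)%nat -> zero_mult (Bm i) a i /\ zero_mult (Bm i) b (m - i)).

Definition is_control_points (m : nat) (Bm : nat -> R -> R) (P : R -> R)
  (eta : nat -> R) : Prop :=
  forall t, 0 < t -> P t = sum_f_R0 (fun i => Bm i t * eta i) m.

(* max_{0 <= i <= m} g i  (for nonnegative g) *)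
Definition max_upto (m : nat) (g : nat -> R) : R :=
  fold_right Rmax 0 (map g (seq 0 (S m))).

(* Main.v *)
Require Import Defs.
From Stdlib Require Import Reals Lra Lia Arith List.
Open Scope R_scope.

(** Put [A = - ln a].  The coefficient functional of [B i] is a differential operator of order at
    most [i] at [a] and one of order at most [m - i] at [1].  Applied to the powers [t ^ r_j], this
    says that [eta_i (t ^ r_j) = q (r_j)], where [q] has degree at most [m - i], [q 0 = 1], and
    [q (r_j) = p (r_j) exp (- A r_j)] for [j <= m] with [p] of degree at most [i]: a rational
    interpolation problem for the exponential.  Its signs are controlled by Rolle's theorem.

    Upper bound: the points [(eta_i (t ^ r_1), eta_i (t ^ r_k))] form a convex polygon and [B i >= 0]
    on [[a, 1]], so by Jensen's inequality the polygon lies below the curve [y = x ^ (r_k / r_1)].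

    Lower bound: [q] is a nonnegative combination of the products [prod_(l > j) (1 - x / r_l)], the
    control points over [[0, 1]].  By the divergence of [sum 1 / r_l], their values at [r_1] and
    [r_k] satisfy the claimed relation up to [o(1)], uniformly in [j], and Jensen's inequality for
    the convex function [x ^ (r_k / r_1)] transfers the bound to [q]. *)

(** * Polynomial functions *)

(** Horner form of the polynomials of degree below [n]; index 0 leaves only the zero function. The
    recursion peels off the constant term, which is the shape that [jet_vanishes_poly] consumes. *)
Fixpoint poly_lt (n : nat) (f : R -> R) : Prop :=
  match n with
  | O => forall x, f x = 0
  | S n => exists (c : R) (g : R -> R), poly_lt n g /\ forall x, f x = c + x * g x
  end.

(* Degree at most [n], and [l] (possibly zero) is the coefficient of [x ^ n]. *)
Definition lead (n : nat) (l : R) (f : R -> R) : Prop :=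
  poly_lt n (fun x => f x - l * x ^ n).

Lemma poly_lt_ext n f g : poly_lt n f -> (forall x, f x = g x) -> poly_lt n g.
Proof.
  destruct n as [|n]; simpl.
  - intros H E x. rewrite <- E. apply H.
  - intros (c & h & Hh & H) E. exists c, h. split; [exact Hh|].
    intro x. rewrite <- E. apply H.
Qed.

Lemma poly_lt_lin n u v : forall f g, poly_lt n f -> poly_lt n g ->
  poly_lt n (fun x => u * f x + v * g x).
Proof.
  induction n as [|n IH]; simpl.
  - intros f g Hf Hg x. rewrite Hf, Hg. ring.
  - intros f g (c & f1 & Hf1 & Hf) (d & g1 & Hg1 & Hg).
    exists (u * c + v * d), (fun x => u * f1 x + v * g1 x).
    split; [now apply IH|]. intro x. rewrite Hf, Hg. ring.
Qed.

Lemma poly_lt_S n : forall f, poly_lt n f -> poly_lt (S n) f.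
Proof.
  induction n as [|n IH]; intros f Hf.
  - exists 0, (fun _ => 0). split; [intro; reflexivity|].
    intro x. rewrite (Hf x). ring.
  - destruct Hf as (c & g & Hg & H). exists c, g. split; [now apply IH|exact H].
Qed.

Lemma poly_lt_le n p f : (n <= p)%nat -> poly_lt n f -> poly_lt p f.
Proof. induction 1; auto using poly_lt_S. Qed.

Lemma poly_lt_0 n : poly_lt n (fun _ => 0).
Proof. apply (poly_lt_le 0); [lia|]. intro; reflexivity. Qed.

Lemma poly_lt_pow n : poly_lt (S n) (fun x => x ^ n).
Proof.
  induction n as [|n IH].
  - exists 1, (fun _ => 0). split; [intro; reflexivity|]. intro x; simpl; ring.
  - exists 0, (fun x => x ^ n). split; [exact IH|]. intro x; simpl; ring.
Qed.

Lemma poly_lt_mul n b f : poly_lt n f -> poly_lt (S n) (fun x => (x - b) * f x).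
Proof.
  intro Hf. apply (poly_lt_ext _ (fun x => 1 * (x * f x) + - b * f x));
    [|intro; ring].
  apply poly_lt_lin; [|now apply poly_lt_S].
  exists 0, f. split; [exact Hf|]. intro; ring.
Qed.

Lemma poly_lt_shift n b : forall f, poly_lt n f -> poly_lt n (fun x => f (x + b)).
Proof.
  induction n as [|n IH]; intros f Hf.
  - intro x. apply Hf.
  - destruct Hf as (c & g & Hg & H).
    apply (poly_lt_ext _ (fun x => 1 * ((x - - b) * g (x + b)) + c * x ^ 0)).
    + apply poly_lt_lin.
      * apply poly_lt_mul with (f := fun x => g (x + b)). now apply IH.
      * apply (poly_lt_le 1); [lia|apply poly_lt_pow].
    + intro x. rewrite (H (x + b)). simpl. ring.
Qed.

Lemma poly_lt_div n b : forall f, poly_lt (S n) f ->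
  exists g, poly_lt n g /\ forall x, f x = f b + (x - b) * g x.
Proof.
  induction n as [|n IH]; intros f (c & g & Hg & H).
  - exists (fun _ => 0). split; [intro; reflexivity|].
    intro x. rewrite (H x), (H b), (Hg x), (Hg b). ring.
  - destruct (IH g Hg) as (h & Hh & E).
    exists (fun x => g b + x * h x). split; [exists (g b), h; auto|].
    intro x. rewrite (H x), (H b), (E x). ring.
Qed.

Lemma derivable_pt_lim_eq f x l l' :
  derivable_pt_lim f x l -> l = l' -> derivable_pt_lim f x l'.
Proof. now intros H <-. Qed.

Lemma poly_lt_derive n : forall f, poly_lt n f ->
  exists g, poly_lt (pred n) g /\ forall x, derivable_pt_lim f x (g x).
Proof.
  induction n as [|n IH]; intros f Hf.
  - exists (fun _ => 0). split; [intro; reflexivity|]. intro x.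
    apply (derivable_pt_lim_ext (fct_cte 0)); [intro; now rewrite (Hf z)|].
    apply derivable_pt_lim_const.
  - destruct Hf as (c & g & Hg & H).
    destruct (IH g Hg) as (g' & Hg' & D).
    exists (fun x => g x + x * g' x). split.
    + destruct n as [|n].
      * simpl. intro x. rewrite (Hg x), (Hg' x). ring.
      * apply (poly_lt_ext _ (fun x => 1 * g x + 1 * ((x - 0) * g' x))).
        -- apply poly_lt_lin; [exact Hg|]. now apply poly_lt_mul.
        -- intro; ring.
    + intro x.
      apply (derivable_pt_lim_ext (plus_fct (fct_cte c) (mult_fct id g)));
        [intro z; rewrite (H z); reflexivity|].
      eapply derivable_pt_lim_eq.
      * apply derivable_pt_lim_plus; [apply derivable_pt_lim_const|].
        apply derivable_pt_lim_mult; [apply derivable_pt_lim_id|apply D].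
      * unfold id. ring.
Qed.

Lemma lead_exists n f : poly_lt (S n) f -> exists l, lead n l f.
Proof.
  revert f. induction n as [|n IH]; intros f (c & g & Hg & H).
  - exists c. intro x. rewrite (H x), (Hg x). simpl. ring.
  - destruct (IH g Hg) as (l & Hl). exists l, c, (fun x => g x - l * x ^ n).
    split; [exact Hl|]. intro x. rewrite (H x). simpl. ring.
Qed.

Lemma lead_ext n l f g : lead n l f -> (forall x, f x = g x) -> lead n l g.
Proof. intros H E. apply (poly_lt_ext _ _ _ H). intro x. now rewrite E. Qed.

Lemma lead_lin n u v l f l' g : lead n l f -> lead n l' g ->
  lead n (u * l + v * l') (fun x => u * f x + v * g x).
Proof.
  intros H H'. eapply poly_lt_ext; [apply (poly_lt_lin n u v _ _ H H')|].
  intro x; cbv beta; ring.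
Qed.

Lemma poly_lt_lead n f : poly_lt n f -> lead n 0 f.
Proof. intro H. apply (poly_lt_ext _ _ _ H). intro; ring. Qed.

Lemma lead_poly_lt n l f : lead n l f -> poly_lt (S n) f.
Proof.
  intro H. eapply poly_lt_ext.
  - apply (poly_lt_lin (S n) 1 l); [apply poly_lt_S, H|apply (poly_lt_pow n)].
  - intro x; cbv beta; ring.
Qed.

Lemma lead_mul n b l f : lead n l f -> lead (S n) l (fun x => (x - b) * f x).
Proof.
  intro H. eapply poly_lt_ext.
  - apply (poly_lt_lin (S n) 1 (- b * l)); [apply (poly_lt_mul n b _ H)|apply (poly_lt_pow n)].
  - intro x; cbv beta; simpl; ring.
Qed.

Lemma lead_derive n l f : lead (S n) l f ->
  exists g, lead n (INR (S n) * l) g /\ forall x, derivable_pt_lim f x (g x).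
Proof.
  intro H. destruct (poly_lt_derive _ _ H) as (h & Hh & D).
  exists (fun x => h x + l * (INR (S n) * x ^ n)). split.
  - apply (poly_lt_ext _ _ _ Hh). intro x; cbv beta; ring.
  - intro x.
    apply (derivable_pt_lim_ext
      (plus_fct (fun x => f x - l * x ^ S n) (mult_real_fct l (fun x => x ^ S n)))).
    + intro z. unfold plus_fct, mult_real_fct. ring.
    + apply derivable_pt_lim_plus; [apply D|].
      apply derivable_pt_lim_scal, (derivable_pt_lim_pow x (S n)).
Qed.

(** * Counting zeros of exponential polynomials *)

(** At least [n] distinct zeros, listed in increasing order. Each zero found becomes the lower bound
    for the rest, so distinctness needs no separate clause. *)
Fixpoint zeros_above (n : nat) (f : R -> R) (lo : R) : Prop :=
  match n with
  | O => True
  | S n => exists z, lo < z /\ f z = 0 /\ zeros_above n f z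
  end.

Lemma zeros_above_ext n f g : forall lo,
  zeros_above n f lo -> (forall x, f x = g x) -> zeros_above n g lo.
Proof.
  induction n as [|n IH]; simpl; [auto|].
  intros lo (z & Hz & Hf & Hn) E. exists z. rewrite <- E. auto.
Qed.

Lemma zeros_above_lower n f lo lo' : lo' <= lo -> zeros_above n f lo -> zeros_above n f lo'.
Proof.
  destruct n; simpl; [auto|]. intros H (z & Hz & Hr). exists z. split; [lra|exact Hr].
Qed.

Lemma zeros_above_le n p f : (n <= p)%nat -> forall lo, zeros_above p f lo -> zeros_above n f lo.
Proof.
  revert p. induction n as [|n IH]; simpl; [auto|].
  intros [|p] H lo; [lia|]. intros (z & Hz & Hf & Hn).
  exists z. split; [|split]; auto. apply (IH p); [lia|exact Hn].
Qed.

Lemma zeros_above_null n f : (forall x, f x = 0) -> forall lo, zeros_above n f lo.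
Proof.
  intro H. induction n as [|n IH]; simpl; [auto|].
  intro lo. exists (lo + 1). split; [lra|auto].
Qed.

Lemma rolle_zeros n f f' lo : (forall x, derivable_pt_lim f x (f' x)) ->
  zeros_above (S n) f lo -> zeros_above n f' lo.
Proof.
  intro D. assert (G : forall z, f z = 0 -> zeros_above n f z -> zeros_above n f' z).
  { induction n as [|n IH]; simpl; [auto|].
    intros z Hz (z' & Hlt & Hz' & Hn).
    destruct (MVT_cor2 f f' z z' Hlt (fun c _ => D c)) as (xi & E & Hxi).
    exists xi. split; [lra|split].
    - rewrite Hz, Hz' in E. apply (Rmult_eq_reg_r (z' - z)); lra.
    - apply (zeros_above_lower n f' z'); [lra|]. now apply IH. }
  intros (z & Hz & Hf & Hn). apply (zeros_above_lower n f' z); [lra|]. now apply G.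
Qed.

Lemma derivable_pt_lim_expl c s x :
  derivable_pt_lim (fun x => c * exp (- s * x)) x (- (s * c) * exp (- s * x)).
Proof.
  eapply derivable_pt_lim_eq.
  - apply (derivable_pt_lim_scal (fun x => exp (- s * x)) c).
    apply (derivable_pt_lim_comp (fun x => - s * x) exp).
    + apply (derivable_pt_lim_scal id (- s)), derivable_pt_lim_id.
    + apply derivable_pt_lim_exp.
  - cbv beta. ring.
Qed.

(* Rolle for the operator [f |-> f' + A f = exp (- A x) (exp (A x) f)']. *)
Lemma rolle_zeros_exp A n f f' lo : (forall x, derivable_pt_lim f x (f' x)) ->
  zeros_above (S n) f lo -> zeros_above n (fun x => f' x + A * f x) lo.
Proof.
  intros D H.
  (* The factor is exp (A x), written in the form whose derivative [derivable_pt_lim_expl] supplies;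
     it has no zeros. *)
  assert (H1 : zeros_above (S n) (fun x => f x * (1 * exp (- (- A) * x))) lo).
  { revert lo H. generalize (S n). intro p.
    induction p as [|p IH]; simpl; [auto|].
    intros lo (z & Hz & Hf & Hp). exists z. rewrite Hf. split; [exact Hz|split; [ring|auto]]. }
  apply (rolle_zeros n _ (fun x => (f' x + A * f x) * exp (A * x))) in H1.
  - clear H. revert lo H1. induction n as [|n IH]; simpl; [auto|].
    intros lo (z & Hz & Hf & Hp). exists z. split; [exact Hz|split; [|auto]].
    pose proof (exp_pos (A * z)). apply (Rmult_eq_reg_r (exp (A * z))); lra.
  - intro x. eapply derivable_pt_lim_eq.
    + apply (derivable_pt_lim_mult f (fun x => 1 * exp (- (- A) * x))); [apply D|apply derivable_pt_lim_expl].
    + cbv beta. rewrite Ropp_involutive. ring.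
Qed.

(** By Rolle, [d] derivatives leave one zero z. They turn [Q] into d! l and the exponential into
    (-s)^d c exp (- s z), so the signs of [l] and [c] are tied together. The factor [K] is s^d exp
    (- s z) / d!. *)
Lemma lead_sign_exp s (Hs : 0 <= s) d : forall l Q c lo, lead d l Q ->
  zeros_above (S d) (fun x => Q x - c * exp (- s * x)) lo ->
  exists K, 0 <= K /\ (0 < s -> 0 < K) /\ l * (-1) ^ d = K * c.
Proof.
  induction d as [|d IH]; intros l Q c lo HQ HZ.
  - destruct HZ as (z & _ & Hz & _). exists (exp (- s * z)).
    pose proof (exp_pos (- s * z)). pose proof (HQ z) as E. cbv beta in Hz. simpl in *.
    split; [lra|split; [lra|]]. replace (Q z) with l in Hz by lra. lra.
  - destruct (lead_derive _ _ _ HQ) as (Q' & HQ' & D).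
    apply (rolle_zeros _ _ (fun x => Q' x - (- (s * c)) * exp (- s * x))) in HZ.
    + destruct (IH _ _ _ _ HQ' HZ) as (K & HK & HK' & E).
      assert (Hd : 0 < INR (S d)) by (apply lt_0_INR; lia).
      exists (K * s / INR (S d)). split; [|split].
      * apply Rle_mult_inv_pos; [apply Rmult_le_pos|]; auto.
      * intro H. apply Rdiv_lt_0_compat; [apply Rmult_lt_0_compat|]; auto.
      * apply (Rmult_eq_reg_l (INR (S d))); [|lra].
        replace (INR (S d) * (l * (-1) ^ S d)) with (- (INR (S d) * l * (-1) ^ d)) by (simpl pow; ring).
        rewrite E. field. lra.
    + intro x. apply derivable_pt_lim_minus with (f1 := Q) (f2 := fun x => c * exp (- s * x));
        [apply D|apply derivable_pt_lim_expl].
Qed.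

Lemma lead_derive_exp A d l Q : lead d l Q ->
  exists Q', (forall x, derivable_pt_lim Q x (Q' x)) /\ lead d (A * l) (fun x => Q' x + A * Q x).
Proof.
  intro H. destruct (poly_lt_derive _ _ (lead_poly_lt _ _ _ H)) as (Q' & HQ' & D).
  exists Q'. split; [exact D|].
  eapply poly_lt_ext; [apply (poly_lt_lin d 1 A _ _ HQ' H)|]. intro x; cbv beta; ring.
Qed.

Lemma derivable_pt_lim_mul_exp A P P' x : derivable_pt_lim P x (P' x) ->
  derivable_pt_lim (fun x => P x * exp (- A * x)) x ((P' x - A * P x) * exp (- A * x)).
Proof.
  intro D. apply (derivable_pt_lim_ext (mult_fct P (fun x => 1 * exp (- A * x)))).
  - intro z. unfold mult_fct. ring.
  - eapply derivable_pt_lim_eq.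
    + apply derivable_pt_lim_mult; [exact D|apply derivable_pt_lim_expl].
    + cbv beta. ring.
Qed.

(** Each application of f' + A f costs one zero, lowers the degree of [P], multiplies [l] by [A] and
    [c] by A - s >= 0. After [e] applications [P] is gone and [lead_sign_exp] applies. *)
Lemma lead_sign_exp2 A s (HA : 0 < A) (Hs : 0 <= s <= A) d e : forall l Q P c lo,
  lead d l Q -> poly_lt e P ->
  zeros_above (S (d + e)) (fun x => Q x - c * exp (- s * x) - P x * exp (- A * x)) lo ->
  exists K, 0 <= K /\ l * (-1) ^ d = K * c.
Proof.
  induction e as [|e IH]; intros l Q P c lo HQ HP HZ.
  - destruct (lead_sign_exp s (proj1 Hs) d l Q c lo HQ) as (K & HK & _ & E); [|now exists K].
    rewrite Nat.add_0_r in HZ. apply (zeros_above_ext _ _ _ _ HZ).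
    intro x. rewrite (HP x). ring.
  - destruct (lead_derive_exp A _ _ _ HQ) as (Q' & DQ & HQ').
    destruct (poly_lt_derive _ _ HP) as (P' & HP' & DP). simpl in HP'.
    rewrite Nat.add_succ_r in HZ.
    apply (rolle_zeros_exp A _ _ (fun x => Q' x - (- (s * c)) * exp (- s * x)
             - (P' x - A * P x) * exp (- A * x))) in HZ.
    + destruct (IH (A * l) (fun x => Q' x + A * Q x) P' ((A - s) * c) lo HQ' HP')
        as (K & HK & E).
      { apply (zeros_above_ext _ _ _ _ HZ). intro x. ring. }
      exists (K * (A - s) / A). split.
      * apply Rle_mult_inv_pos; [apply Rmult_le_pos|]; lra.
      * apply (Rmult_eq_reg_l A); [|lra].
        rewrite <- Rmult_assoc, E. field. lra.
    + intro x.
      apply derivable_pt_lim_minus with (f1 := fun x => Q x - c * exp (- s * x)) (f2 := fun x => P x * exp (- A * x)).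
      * apply derivable_pt_lim_minus with (f1 := Q) (f2 := fun x => c * exp (- s * x));
        [apply DQ|apply derivable_pt_lim_expl].
      * apply derivable_pt_lim_mul_exp, DP.
Qed.

(** Here [e] applications of f' + A f reduce [P] to the constant e! c, so [lead_sign_exp] applies
    with s = A > 0, which makes [K] strictly positive. *)
Lemma lead_sign_lead A (HA : 0 < A) d e : forall l Q c P lo,
  lead d l Q -> lead e c P ->
  zeros_above (S (d + e)) (fun x => Q x - P x * exp (- A * x)) lo ->
  exists K, 0 < K /\ l * (-1) ^ d = K * c.
Proof.
  induction e as [|e IH]; intros l Q c P lo HQ HP HZ.
  - destruct (lead_sign_exp A (Rlt_le _ _ HA) d l Q c lo HQ) as (K & _ & HK & E);
      [|exists K; auto].
    rewrite Nat.add_0_r in HZ. apply (zeros_above_ext _ _ _ _ HZ).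
    intro x. pose proof (HP x) as E. simpl in E. replace (P x) with c by lra. reflexivity.
  - destruct (lead_derive_exp A _ _ _ HQ) as (Q' & DQ & HQ').
    destruct (lead_derive _ _ _ HP) as (P' & HP' & DP).
    rewrite Nat.add_succ_r in HZ.
    apply (rolle_zeros_exp A _ _ (fun x => Q' x - (P' x - A * P x) * exp (- A * x))) in HZ.
    + destruct (IH (A * l) (fun x => Q' x + A * Q x) (INR (S e) * c) P' lo HQ' HP')
        as (K & HK & E).
      { apply (zeros_above_ext _ _ _ _ HZ). intro x. ring. }
      assert (He : 0 < INR (S e)) by (apply lt_0_INR; lia).
      exists (K * INR (S e) / A). split.
      * apply Rdiv_lt_0_compat; [apply Rmult_lt_0_compat|]; auto.
      * apply (Rmult_eq_reg_l A); [|lra].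
        rewrite <- Rmult_assoc, E. field. lra.
    + intro x.
      apply derivable_pt_lim_minus with (f1 := Q) (f2 := fun x => P x * exp (- A * x));
        [apply DQ|apply derivable_pt_lim_mul_exp, DP].
Qed.

Lemma pow_m1_neq d : (-1) ^ d <> 0.
Proof. apply pow_nonzero. lra. Qed.

Lemma lead_unique n l l' f : lead n l f -> lead n l' f -> l = l'.
Proof.
  intros H H'.
  destruct (lead_sign_exp 0 (Rle_refl 0) n (1 * l + -1 * l') (fun x => 1 * f x + -1 * f x) 0 0)
    as (K & _ & _ & E).
  - now apply lead_lin.
  - apply zeros_above_null. intro x. ring.
  - rewrite Rmult_0_r in E. apply Rmult_integral in E.
    destruct E as [E|E]; [lra|]. now apply pow_m1_neq in E.
Qed.

(** The functions x^i and x^j exp (- A x) form a Chebyshev system: with as many zeros as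
    coefficients, the sign lemma with c = 0 removes the leading coefficients of [Q] one by one, then
    those of [P]. *)
Lemma exp_poly_zero A (HA : 0 < A) d e Q P lo : poly_lt d Q -> poly_lt e P ->
  zeros_above (d + e) (fun x => Q x - P x * exp (- A * x)) lo ->
  (forall x, Q x = 0) /\ (forall x, P x = 0).
Proof.
  revert e. revert Q P lo.
  assert (G : forall e P lo, poly_lt e P ->
            zeros_above e (fun x => P x - 0 * exp (- A * x)) lo -> forall x, P x = 0).
  { induction e as [|e IH]; intros P lo HP HZ; [exact HP|].
    destruct (lead_exists _ _ HP) as (l & Hl).
    destruct (lead_sign_exp A (Rlt_le _ _ HA) _ _ _ _ _ Hl HZ) as (K & _ & _ & E).
    rewrite Rmult_0_r in E. apply Rmult_integral in E.
    destruct E as [E|E]; [|now apply pow_m1_neq in E]. subst l.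
    apply (IH P lo); [|apply (zeros_above_le e (S e)); [lia|exact HZ]].
    apply (poly_lt_ext _ _ _ Hl). intro; ring. }
  induction d as [|d IH]; intros Q P lo e HQ HP HZ.
  - split; [exact HQ|]. apply (G e P lo HP).
    clear - HQ HZ. simpl in HZ, HQ. revert lo HZ. induction e as [|e IH]; simpl; [auto|].
    intros lo (z & Hz & Hf & Hp). exists z. split; [exact Hz|split; [|auto]].
    rewrite HQ in Hf. pose proof (exp_pos (- A * z)).
    rewrite Rmult_0_l, Rminus_0_r. apply (Rmult_eq_reg_r (exp (- A * z))); lra.
  - destruct (lead_exists _ _ HQ) as (l & Hl).
    destruct (lead_sign_exp2 A 0 HA (conj (Rle_refl 0) (Rlt_le _ _ HA)) d e l Q P 0 lo Hl HP)
      as (K & _ & E).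
    { apply (zeros_above_ext _ _ _ _ HZ). intro; ring. }
    rewrite Rmult_0_r in E. apply Rmult_integral in E.
    destruct E as [E|E]; [|now apply pow_m1_neq in E]. subst l.
    apply (IH Q P lo e); [|exact HP|apply (zeros_above_le _ (S d + e)); [lia|exact HZ]].
    apply (poly_lt_ext _ _ _ Hl). intro; ring.
Qed.

(** * Rational interpolation of exponentials *)

Lemma pow_m1_sq d : (-1) ^ d * (-1) ^ d = 1.
Proof. rewrite <- Rpow_mult_distr. replace (-1 * -1) with 1 by ring. apply pow1. Qed.

(* Product of [r j - x] over the last [d] indices [j <= m]. *)
Fixpoint node_prod (r : nat -> R) (m d : nat) (x : R) : R :=
  match d with
  | O => 1
  | S d => node_prod r m d x * (r (m - d)%nat - x)
  end.

(** Nonnegative combinations of node products. Any inequality linear in the function passes to the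
    whole cone by induction; the range of [d] includes the full product, which vanishes at every
    node. *)
Inductive node_cone (r : nat -> R) (m : nat) : (R -> R) -> Prop :=
| node_cone_term (w : R) (d : nat) (f : R -> R) :
    0 <= w -> (d <= S m)%nat -> (forall x, f x = w * node_prod r m d x) -> node_cone r m f
| node_cone_add (f g h : R -> R) :
    node_cone r m f -> node_cone r m g -> (forall x, h x = f x + g x) -> node_cone r m h.

Lemma node_cone_scal r m u f g : 0 <= u ->
  node_cone r m f -> (forall x, g x = u * f x) -> node_cone r m g.
Proof.
  intros Hu H. revert g. induction H as [w d f Hw Hd E|f g h _ IHf _ IHg E]; intros g' E'.
  - apply (node_cone_term r m (u * w) d); auto.
    + now apply Rmult_le_pos.
    + intro x. rewrite E', E. ring.
  - apply (node_cone_add r m (fun x => u * f x) (fun x => u * g x)).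
    + now apply IHf.
    + now apply IHg.
    + intro x. rewrite E', E. ring.
Qed.

Lemma node_prod_lead r m d : lead d ((-1) ^ d) (node_prod r m d).
Proof.
  induction d as [|d IH].
  - intro x. simpl. ring.
  - eapply poly_lt_ext.
    + apply (poly_lt_lin (S d) (-1) 0 _ _
        (lead_mul d (r (m - d)%nat) _ _ IH) (lead_mul d (r (m - d)%nat) _ _ IH)).
    + intro x. simpl. ring.
Qed.

Lemma increasing_lt r (hinc : forall n, r n < r (S n)) i j : (i < j)%nat -> r i < r j.
Proof. induction 1; [auto|]. pose proof (hinc m). lra. Qed.

Lemma increasing_le r (hinc : forall n, r n < r (S n)) i j : (i <= j)%nat -> r i <= r j.
Proof.
  intro H. destruct (Nat.eq_dec i j) as [<-|N]; [lra|].
  apply Rlt_le, increasing_lt; [exact hinc|lia].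
Qed.

Lemma node_prod_zero r m d j : (j <= m)%nat -> (m < j + d)%nat -> node_prod r m d (r j) = 0.
Proof.
  intro Hj. induction d as [|d IH]; intro H; [lia|]. simpl.
  destruct (Nat.eq_dec j (m - d)) as [->|N]; [ring|]. rewrite IH by lia. ring.
Qed.

(** Either [r j] is one of the nodes of the product, or it lies to the left of all of them. *)
Lemma node_prod_nonneg r (hinc : forall n, r n < r (S n)) m d j :
  (d <= S m)%nat -> (j <= m)%nat -> 0 <= node_prod r m d (r j).
Proof.
  intros Hd Hj. induction d as [|d IH]; simpl; [lra|].
  destruct (le_lt_dec (m - d) j) as [L|L].
  - replace (node_prod r m d (r j) * (r (m - d)%nat - r j)) with 0; [lra|].
    symmetry. apply (node_prod_zero r m (S d) j); lia.
  - apply Rmult_le_pos; [apply IH; lia|]. pose proof (increasing_lt r hinc j (m - d) L). lra.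
Qed.

Lemma node_cone_nonneg r (hinc : forall n, r n < r (S n)) m f j :
  (j <= m)%nat -> node_cone r m f -> 0 <= f (r j).
Proof.
  intros Hj H. induction H as [w d f Hw Hd E|f g h _ IHf _ IHg E]; rewrite E.
  - apply Rmult_le_pos; [exact Hw|]. now apply node_prod_nonneg.
  - lra.
Qed.

(* Only the last [M] of the nodes [r 0, ..., r m] count. *)
Definition interpolates (r : nat -> R) (m : nat) (A : R) (M : nat) (p q : R -> R) : Prop :=
  forall j, (j <= m)%nat -> (m < j + M)%nat -> q (r j) = p (r j) * exp (- A * r j).

Lemma node_zeros r (hinc : forall n, r n < r (S n)) m f M : forall lo,
  (M <= S m)%nat -> (forall j, (j <= m)%nat -> (m < j + M)%nat -> f (r j) = 0) ->
  lo < r (S m - M)%nat -> zeros_above M f lo.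
Proof.
  induction M as [|M IH]; simpl; [auto|]. intros lo HM Hf Hlo.
  exists (r (m - M)%nat). split; [exact Hlo|split].
  - apply Hf; lia.
  - apply IH; [lia|intros; apply Hf; lia|]. apply increasing_lt; [exact hinc|lia].
Qed.

Lemma interpolates_zeros r (hinc : forall n, r n < r (S n)) m A M p q :
  (M <= S m)%nat -> interpolates r m A M p q ->
  exists lo, zeros_above M (fun x => q x - p x * exp (- A * x)) lo.
Proof.
  intros HM H. exists (r (S m - M)%nat - 1). apply (node_zeros r hinc m); [exact HM| |lra].
  intros j H1 H2. rewrite (H j H1 H2). ring.
Qed.

(** Unisolvence: at most [M] free coefficients against [M] homogeneous conditions at distinct
    nodes. *)
Lemma interpolates_zero r (hinc : forall n, r n < r (S n)) m A (HA : 0 < A) M d e p q :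
  (M <= S m)%nat -> (d + e <= M)%nat -> poly_lt d q -> poly_lt e p ->
  interpolates r m A M p q -> (forall x, q x = 0) /\ (forall x, p x = 0).
Proof.
  intros HM Hde Hq Hp H. destruct (interpolates_zeros r hinc m A M p q HM H) as (lo & Z).
  apply (exp_poly_zero A HA d e q p lo Hq Hp). now apply (zeros_above_le _ M).
Qed.

Lemma interpolates_lin r m A M u v p q p' q' :
  interpolates r m A M p q -> interpolates r m A M p' q' ->
  interpolates r m A M (fun x => u * p x + v * p' x) (fun x => u * q x + v * q' x).
Proof. intros H H' j H1 H2. rewrite (H j H1 H2), (H' j H1 H2). ring. Qed.

Lemma interpolates_S r m A M p q : (M <= m)%nat -> interpolates r m A M p q ->
  q (r (m - M)%nat) = p (r (m - M)%nat) * exp (- A * r (m - M)%nat) ->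
  interpolates r m A (S M) p q.
Proof.
  intros HM H E j H1 H2. destruct (Nat.eq_dec j (m - M)) as [->|N]; [exact E|].
  apply H; lia.
Qed.

(* Adding a node on the left combines two consecutive solutions; the weights [al], [be] have the
   same sign because the two leading coefficients of an interpolating pair determine each other's
   sign ([lead_sign_lead]). *)
Lemma interpolation_exists r (hinc : forall n, r n < r (S n)) m A (HA : 0 < A) M :
  (M <= S m)%nat -> forall I, (I <= S M)%nat -> exists p q : R -> R,
  poly_lt I p /\ poly_lt (S M - I) q /\ interpolates r m A M p q /\
  ((1 <= I)%nat -> exists l, 0 < l /\ lead (I - 1) l p) /\
  ((I <= M)%nat -> exists l, 0 < l /\ lead (M - I) ((-1) ^ (M - I) * l) q) /\
  node_cone r m q.
Proof.
  induction M as [M IH] using lt_wf_ind. intros HM I HI.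
  destruct I as [|e]; [|destruct (Nat.eq_dec e M) as [->|Ne]].
  (* The two extreme indices: one component is zero and the other is the product vanishing at all
     [M] nodes. *)
  - exists (fun _ => 0), (node_prod r m M). rewrite !Nat.sub_0_r.
    pose proof (node_prod_lead r m M) as HL.
    split; [intro; reflexivity|]. split; [apply (lead_poly_lt _ _ _ HL)|].
    split; [intros j H1 H2; rewrite node_prod_zero by auto; ring|].
    split; [intro; lia|]. split.
    + intros _. exists 1. split; [lra|]. now rewrite Rmult_1_r.
    + apply (node_cone_term r m 1 M); [lra|exact HM|]. intro; ring.
  - pose proof (node_prod_lead r m M) as HL.
    (* The sign makes the leading coefficient 1; the summand of weight 0 gives the scaling the
       two-term shape of [lead_lin]. *)
    assert (HL1 : lead M 1 (fun x => (-1) ^ M * node_prod r m M x + 0 * node_prod r m M x)).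
    { pose proof (lead_lin _ ((-1) ^ M) 0 _ _ _ _ HL HL) as H. rewrite Rmult_0_l, Rplus_0_r in H.
      now rewrite pow_m1_sq in H. }
    exists (fun x => (-1) ^ M * node_prod r m M x + 0 * node_prod r m M x), (fun _ => 0).
    replace (S M - 1)%nat with M by lia. split; [apply (lead_poly_lt _ _ _ HL1)|].
    split; [apply poly_lt_0|].
    split; [intros j H1 H2; rewrite node_prod_zero by auto; ring|].
    split; [|split].
    + intros _. exists 1. split; [lra|exact HL1].
    + intro; lia.
    + apply (node_cone_term r m 0 0); [lra|lia|]. intro; ring.
  - destruct M as [|M]; [lia|].
    destruct (IH M ltac:(lia) ltac:(lia) e ltac:(lia))
      as (p1 & q1 & Hp1 & Hq1 & N1 & _ & HL1 & C1).
    destruct (IH M ltac:(lia) ltac:(lia) (S e) ltac:(lia))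
      as (p2 & q2 & Hp2 & Hq2 & N2 & HL2 & _ & C2).
    destruct (HL1 ltac:(lia)) as (l1 & Hl1 & L1).
    destruct (HL2 ltac:(lia)) as (l2 & Hl2 & L2).
    replace (S e - 1)%nat with e in L2 by lia.
    replace (S M - e)%nat with (S (M - e)) in Hq1 by lia.
    replace (S M - S e)%nat with (M - e)%nat in Hq2 |- * by lia.
    set (x0 := r (m - M)%nat).
    set (f1 := q1 x0 - p1 x0 * exp (- A * x0)).
    set (f2 := q2 x0 - p2 x0 * exp (- A * x0)).
    assert (HP : forall al be, lead e (be * l2) (fun x => al * p1 x + be * p2 x)).
    { intros al be. pose proof (lead_lin _ al be _ _ _ _ (poly_lt_lead _ _ Hp1) L2) as H.
      now rewrite Rmult_0_r, Rplus_0_l in H. }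
    assert (HQ : forall al be, lead (M - e) ((-1) ^ (M - e) * (al * l1)) (fun x => al * q1 x + be * q2 x)).
    { intros al be. pose proof (lead_lin _ al be _ _ _ _ L1 (poly_lt_lead _ _ Hq2)) as H.
      rewrite Rmult_0_r, Rplus_0_r in H.
      now replace ((-1) ^ (M - e) * (al * l1)) with (al * ((-1) ^ (M - e) * l1)) by ring. }
    (* A zero residual at the new node [x0] would make the second pair a solution with as many
       conditions as coefficients, hence zero, against [l2] > 0. *)
    assert (Hf2 : f2 <> 0).
    { intro Z. destruct (interpolates_zero r hinc m A HA (S M) (M - e) (S e) p2 q2) as [_ Zp]; auto.
      - lia.
      - apply interpolates_S; [lia|exact N2|]. fold x0. unfold f2 in Z. lra.
      - apply (Rlt_not_eq _ _ Hl2). symmetry. apply (lead_unique e _ _ _ L2).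
        apply (poly_lt_ext _ (fun _ => 0)); [apply poly_lt_0|]. intro x. rewrite Zp. ring. }
    assert (NN : forall al be, al * f1 + be * f2 = 0 ->
              interpolates r m A (S M) (fun x => al * p1 x + be * p2 x) (fun x => al * q1 x + be * q2 x)).
    { intros al be E. apply interpolates_S; [lia|now apply interpolates_lin|].
      fold x0. unfold f1, f2 in E. lra. }
    assert (G : exists al be, 0 < al /\ 0 < be /\ al * f1 + be * f2 = 0).
    (* The weights [f2] and - [f1] cancel the residual at [x0]. Comparing leading coefficients of
       the resulting pair shows that they have the same sign; if both are negative, both are
       flipped. *)
    { destruct (interpolates_zeros r hinc m A (S M) _ _ HM (NN f2 (- f1) ltac:(ring))) as (lo & Z).
      destruct (lead_sign_lead A HA (M - e) e _ _ _ _ lo (HQ f2 (- f1)) (HP f2 (- f1)))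
        as (K & HK & E).
      { now replace (M - e + e)%nat with M by lia. }
      assert (E1 : f2 * l1 = K * l2 * - f1).
      { replace (f2 * l1) with ((-1) ^ (M - e) * (f2 * l1) * (-1) ^ (M - e)); [rewrite E; ring|].
        replace ((-1) ^ (M - e) * (f2 * l1) * (-1) ^ (M - e))
          with ((-1) ^ (M - e) * (-1) ^ (M - e) * (f2 * l1)) by ring.
        rewrite pow_m1_sq. ring. }
      assert (HKl : 0 < K * l2) by now apply Rmult_lt_0_compat.
      assert (E2 : - f1 = f2 * (l1 / (K * l2))) by (apply (Rmult_eq_reg_l (K * l2)); [rewrite <- E1; field; lra|lra]).
      assert (Hr : 0 < l1 / (K * l2)) by now apply Rdiv_lt_0_compat.
      destruct (Rtotal_order f2 0) as [L|[L|L]]; [|contradiction|].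
      - exists (- f2), f1. split; [lra|split; [|ring]].
        replace f1 with (- f2 * (l1 / (K * l2))) by lra. apply Rmult_lt_0_compat; lra.
      - exists f2, (- f1). split; [lra|split; [|ring]].
        rewrite E2. apply Rmult_lt_0_compat; lra. }
    destruct G as (al & be & Ha & Hb & E).
    exists (fun x => al * p1 x + be * p2 x), (fun x => al * q1 x + be * q2 x).
    replace (S (S M) - S e)%nat with (S (M - e)) by lia. replace (S e - 1)%nat with e by lia.
    split; [apply (lead_poly_lt _ _ _ (HP al be))|].
    split; [apply (lead_poly_lt _ _ _ (HQ al be))|].
    split; [now apply NN|]. split; [|split].
    + intros _. exists (be * l2). split; [now apply Rmult_lt_0_compat|apply HP].
    + intros _. exists (al * l1). split; [now apply Rmult_lt_0_compat|apply HQ].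
    + apply (node_cone_add r m (fun x => al * q1 x) (fun x => be * q2 x)); [| |auto].
      * apply (node_cone_scal r m al q1); [lra|exact C1|auto].
      * apply (node_cone_scal r m be q2); [lra|exact C2|auto].
Qed.

(** * Normalized pairs and their differences *)

(** The exponential has no zeros, so [p] vanishes at the leftmost node together with [q]. Dividing
    both by the same linear factor preserves the conditions at the other nodes. *)
Lemma interpolates_div r (hinc : forall n, r n < r (S n)) m A M i j p q :
  (M <= m)%nat -> poly_lt (S i) p -> poly_lt (S j) q -> interpolates r m A (S M) p q ->
  q (r (m - M)%nat) = 0 -> exists p1 q1,
  poly_lt i p1 /\ poly_lt j q1 /\ interpolates r m A M p1 q1 /\
  (forall x, p x = (x - r (m - M)%nat) * p1 x) /\ (forall x, q x = (x - r (m - M)%nat) * q1 x).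
Proof.
  intros HM Hp Hq N Z.
  assert (Zp : p (r (m - M)%nat) = 0).
  { rewrite (N (m - M)%nat) in Z by lia. pose proof (exp_pos (- A * r (m - M)%nat)).
    apply (Rmult_eq_reg_r (exp (- A * r (m - M)%nat))); lra. }
  destruct (poly_lt_div i (r (m - M)%nat) p Hp) as (p1 & Hp1 & Ep).
  destruct (poly_lt_div j (r (m - M)%nat) q Hq) as (q1 & Hq1 & Eq).
  exists p1, q1. split; [exact Hp1|split; [exact Hq1|split; [|split]]].
  - intros k H1 H2. pose proof (increasing_lt r hinc (m - M) k ltac:(lia)).
    apply (Rmult_eq_reg_l (r k - r (m - M)%nat)); [|lra].
    pose proof (N k H1 ltac:(lia)) as E. rewrite Ep, Eq, Z, Zp in E. lra.
  - intro x. rewrite Ep, Zp. ring.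
  - intro x. rewrite Eq, Z. ring.
Qed.

(** There are [M] + 1 coefficients and [M] homogeneous conditions; the value 1 at the leftmost node
    fixes the scale. For [M] = [S m] that node is [r 0]. *)
Definition normalized_pair (r : nat -> R) (m : nat) (A : R) (M I : nat) (p q : R -> R) : Prop :=
  poly_lt I p /\ poly_lt (S M - I) q /\ interpolates r m A M p q /\
  (exists l, 0 < l /\ lead (I - 1) l p) /\
  (exists l, 0 < l /\ lead (M - I) ((-1) ^ (M - I) * l) q) /\
  node_cone r m q /\ q (r (S m - M)%nat) = 1.

Lemma normalized_pair_exists r (hinc : forall n, r n < r (S n)) m A (HA : 0 < A) M I :
  (M <= S m)%nat -> (1 <= I <= M)%nat -> exists p q, normalized_pair r m A M I p q.
Proof.
  intros HM HI.
  destruct (interpolation_exists r hinc m A HA M HM I ltac:(lia))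
    as (p & q & Hp & Hq & N & HLp & HLq & C).
  destruct (HLp ltac:(lia)) as (l & Hl & Lp). destruct (HLq ltac:(lia)) as (l' & Hl' & Lq).
  set (x0 := r (S m - M)%nat).
  assert (H0 : 0 <= q x0) by (apply (node_cone_nonneg r hinc m); [lia|exact C]).
  assert (Hx : q x0 <> 0).
  (* If [q] vanished at the leftmost node, division would leave as many conditions as coefficients,
     hence p = 0, against its positive leading coefficient. *)
  { intro Z. destruct M as [|M]; [lia|]. destruct I as [|I]; [lia|].
    replace (S (S M) - S I)%nat with (S (M - I)) in Hq by lia.
    destruct (interpolates_div r hinc m A M I (M - I) p q ltac:(lia) Hp Hq N Z)
      as (p1 & q1 & Hp1 & Hq1 & N1 & Ep & _).
    destruct (interpolates_zero r hinc m A HA M (M - I) I p1 q1) as [_ Zp]; auto; try lia.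
    apply (Rlt_not_eq _ _ Hl). symmetry. apply (lead_unique _ _ _ _ Lp).
    apply (poly_lt_ext _ (fun _ => 0)); [apply poly_lt_0|]. intro x. rewrite Ep, Zp. ring. }
  assert (Hi : 0 < / q x0) by (apply Rinv_0_lt_compat; lra).
  exists (fun x => / q x0 * p x + 0 * p x), (fun x => / q x0 * q x + 0 * q x).
  split; [now apply poly_lt_lin|]. split; [now apply poly_lt_lin|].
  split; [now apply interpolates_lin|].
  split; [|split; [|split]].
  - exists (/ q x0 * l + 0 * l). split; [|now apply lead_lin].
    rewrite Rmult_0_l, Rplus_0_r. now apply Rmult_lt_0_compat.
  - exists (/ q x0 * l' + 0 * l'). split.
    + rewrite Rmult_0_l, Rplus_0_r. now apply Rmult_lt_0_compat.
    + pose proof (lead_lin _ (/ q x0) 0 _ _ _ _ Lq Lq) as H.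
      match type of H with lead _ ?a _ => match goal with |- lead _ ?b _ =>
        replace b with a by ring end end. exact H.
  - apply (node_cone_scal r m (/ q x0) q); [lra|exact C|]. intro; ring.
  - fold x0. field. exact Hx.
Qed.

(** Both [q1] and [q2] equal 1 at the leftmost node, so the difference of the pairs is divisible by
    the linear factor there. The quotient solves the problem on the remaining nodes, so it is a
    multiple of the pair ([p0], [q0]), and the ratio of positive leading coefficients gives the sign
    of [c]. *)
Lemma normalized_pair_step r (hinc : forall n, r n < r (S n)) m A (HA : 0 < A) M I
  p1 q1 p2 q2 p0 q0 : (M <= m)%nat -> (1 <= I <= M)%nat ->
  normalized_pair r m A (S M) I p1 q1 -> normalized_pair r m A (S M) (S I) p2 q2 ->
  normalized_pair r m A M I p0 q0 ->
  exists c, 0 <= c /\ forall x, q2 x - q1 x = c * (x - r (m - M)%nat) * q0 x.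
Proof.
  intros HM HI (Hp1 & Hq1 & N1 & _ & _ & _ & E1) (Hp2 & Hq2 & N2 & (l2 & Hl2 & L2) & _ & _ & E2)
    (Hp0 & Hq0 & N0 & (l0 & Hl0 & L0) & _).
  destruct I as [|I]; [lia|].
  replace (S (S M) - S I)%nat with (S (S M - S I)) in Hq1 by lia.
  replace (S (S M) - S (S I))%nat with (S M - S I)%nat in Hq2 by lia.
  replace (S (S I) - 1)%nat with (S I) in L2 by lia.
  replace (S I - 1)%nat with I in L0 by lia.
  assert (L : lead (S I) l2 (fun x => 1 * p2 x + -1 * p1 x)).
  { pose proof (lead_lin _ 1 (-1) _ _ _ _ L2 (poly_lt_lead _ _ Hp1)) as H.
    match type of H with lead _ ?a _ => replace a with l2 in H by ring end. exact H. }
  destruct (interpolates_div r hinc m A M (S I) (S M - S I) (fun x => 1 * p2 x + -1 * p1 x)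
             (fun x => 1 * q2 x + -1 * q1 x)) as (p & q & Hp & Hq & N & Ep & Eq); auto.
  - now apply lead_poly_lt with l2.
  - apply poly_lt_lin; [now apply poly_lt_S|exact Hq1].
  - now apply interpolates_lin.
  - simpl in E1, E2. rewrite E1, E2. ring.
  - assert (L' : lead I l2 p).
    { destruct (lead_exists _ _ Hp) as (l & Hl).
      replace l2 with l; [exact Hl|].
      apply (lead_unique (S I) _ _ (fun x => 1 * p2 x + -1 * p1 x)); [|exact L].
      apply (lead_ext _ _ _ _ (lead_mul _ (r (m - M)%nat) _ _ Hl)). intro x. now rewrite Ep. }
    (* This combination cancels the leading terms of [p] and [p0], which brings the number of
       coefficients down to [M]. *)
    destruct (interpolates_zero r hinc m A HA M (S M - S I) I
      (fun x => l0 * p x + - l2 * p0 x) (fun x => l0 * q x + - l2 * q0 x)) as [Z _].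
    + lia.
    + lia.
    + now apply poly_lt_lin.
    + pose proof (lead_lin _ l0 (- l2) _ _ _ _ L' L0) as H.
      apply (poly_lt_ext _ _ _ H). intro x. ring.
    + now apply interpolates_lin.
    + exists (l2 / l0). split; [apply Rlt_le, Rdiv_lt_0_compat; auto|].
      intro x. replace (q2 x - q1 x) with (1 * q2 x + -1 * q1 x) by ring.
      rewrite Eq. replace (q x) with (l2 / l0 * q0 x); [ring|].
      apply (Rmult_eq_reg_l l0); [|lra]. specialize (Z x). field_simplify; [|lra]. lra.
Qed.

(** * Control points as values of interpolating polynomials *)

Lemma sum_f_R0_swap (f : nat -> nat -> R) m n :
  sum_f_R0 (fun i => sum_f_R0 (fun j => f i j) n) m =
  sum_f_R0 (fun j => sum_f_R0 (fun i => f i j) m) n.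
Proof.
  induction m as [|m IH]; simpl; [reflexivity|]. now rewrite IH, <- plus_sum.
Qed.

Lemma sum_f_R0_single (f : nat -> R) m i : (i <= m)%nat ->
  (forall j, (j <= m)%nat -> j <> i -> f j = 0) -> sum_f_R0 f m = f i.
Proof.
  induction m as [|m IH]; intros Hi H.
  - now replace i with 0%nat by lia.
  - simpl. destruct (Nat.eq_dec i (S m)) as [->|N].
    + rewrite (sum_eq _ (fun _ => 0)) by (intros j Hj; apply H; lia).
      rewrite sum_cte. ring.
    + rewrite IH, (H (S m)); [ring|lia|lia|lia|]. intros; apply H; lia.
Qed.

Lemma finite_choice (T : Type) (t0 : T) (P : nat -> T -> Prop) m :
  (forall i, (i <= m)%nat -> exists t, P i t) ->
  exists f : nat -> T, forall i, (i <= m)%nat -> P i (f i).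
Proof.
  induction m as [|m IH]; intro H.
  - destruct (H 0%nat (le_n 0)) as (t & Ht). exists (fun _ => t).
    intros i Hi. now replace i with 0%nat by lia.
  - destruct IH as (f & Hf); [intros; apply H; lia|].
    destruct (H (S m) (le_n _)) as (t & Ht).
    exists (fun i => if Nat.eq_dec i (S m) then t else f i).
    intros i Hi. destruct (Nat.eq_dec i (S m)) as [->|N]; [exact Ht|]. apply Hf; lia.
Qed.

Lemma derivable_pt_lim_pos_ext f g t l : 0 < t ->
  (forall u, 0 < u -> f u = g u) -> derivable_pt_lim f t l -> derivable_pt_lim g t l.
Proof.
  intros Ht E. apply (derivable_pt_lim_locally_ext f g t 0 (t + 1)); [lra|].
  intros z Hz. apply E. lra.
Qed.

Lemma derivable_pt_lim_muntz (c s : nat -> R) m t : 0 < t ->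
  derivable_pt_lim (fun t => sum_f_R0 (fun j => c j * Rpower t (s j)) m) t
    (sum_f_R0 (fun j => c j * s j * Rpower t (s j - 1)) m).
Proof.
  intro Ht.
  assert (D : forall j, derivable_pt_lim (fun t => c j * Rpower t (s j)) t
                (c j * s j * Rpower t (s j - 1))).
  { intro j. rewrite Rmult_assoc.
    apply (derivable_pt_lim_scal (fun t => Rpower t (s j))).
    now apply derivable_pt_lim_power. }
  induction m as [|m IH]; simpl; [apply D|].
  apply derivable_pt_lim_plus with (f2 := fun t => c (S m) * Rpower t (s (S m))); auto.
Qed.

Lemma nth_derive_zero n f h : nth_derive n f h ->
  (forall t, 0 < t -> f t = 0) -> forall t, 0 < t -> h t = 0.
Proof.
  induction 1 as [f|n f g h D _ IH]; [auto|]. intro Z. apply IH.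
  intros t Ht. apply (uniqueness_limite f t); [now apply D|].
  apply (derivable_pt_lim_pos_ext (fct_cte 0)); [exact Ht| |apply derivable_pt_lim_const].
  intros u Hu. now rewrite Z.
Qed.

(** The operator t d/dt multiplies t^s by s, so a polynomial in it of degree below [d] only involves
    derivatives of order below [d]. The induction follows the Horner form of [q]; as f' has
    exponents s_j - 1, the tail [g] is shifted by 1. *)
Lemma jet_vanishes_poly d : forall q (c s : nat -> R) m f x0, poly_lt d q -> 0 < x0 ->
  (forall t, 0 < t -> f t = sum_f_R0 (fun j => c j * Rpower t (s j)) m) ->
  (forall j h, (j < d)%nat -> nth_derive j f h -> h x0 = 0) ->
  sum_f_R0 (fun j => c j * (q (s j) * Rpower x0 (s j))) m = 0.
Proof.
  induction d as [|d IH]; intros q c s m f x0 Hq Hx Hf J.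
  - rewrite (sum_eq _ (fun _ => 0)); [rewrite sum_cte; ring|].
    intros j _. rewrite Hq. ring.
  - destruct Hq as (c0 & g & Hg & Eq).
    pose (f1 := fun t => sum_f_R0 (fun j => c j * s j * Rpower t (s j - 1)) m).
    assert (E1 : sum_f_R0 (fun j => c j * s j * (g (s j - 1 + 1) * Rpower x0 (s j - 1))) m = 0).
    { apply (IH (fun x => g (x + 1)) (fun j => c j * s j) (fun j => s j - 1) m f1 x0); auto.
      - now apply poly_lt_shift.
      - intros j h Hj Hh. apply (J (S j)); [lia|]. apply (ndS j f f1 h); [|exact Hh].
        intros t Ht. apply (derivable_pt_lim_pos_ext (fun t => sum_f_R0 (fun j => c j * Rpower t (s j)) m)).
        + exact Ht.
        + intros u Hu. now rewrite Hf.
        + now apply derivable_pt_lim_muntz. }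
    pose proof (J 0%nat f ltac:(lia) (nd0 f)) as E0. rewrite Hf in E0 by exact Hx.
    transitivity (c0 * sum_f_R0 (fun j => c j * Rpower x0 (s j)) m +
      x0 * sum_f_R0 (fun j => c j * s j * (g (s j - 1 + 1) * Rpower x0 (s j - 1))) m).
    + rewrite !scal_sum, <- plus_sum. apply sum_eq. intros j _.
      replace (Rpower x0 (s j)) with (x0 * Rpower x0 (s j - 1)).
      * rewrite Eq. replace (s j - 1 + 1) with (s j) by ring. ring.
      * rewrite <- (Rpower_1 x0) at 1 by exact Hx. rewrite <- Rpower_plus.
        f_equal. ring.
    + rewrite E0, E1. ring.
Qed.

(* The coefficient functional of [B i] is both a combination of derivatives of order at most [i] at
   [a] and one of derivatives of order at most [m - i] at [1]: this is the interpolating pair. *)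
Lemma control_point_value r m a (ha : 0 < a) B (hB : is_CB_basis r m a 1 B) i p q :
  (i <= m)%nat -> poly_lt (S i) p -> poly_lt (S m - i) q ->
  interpolates r m (- ln a) (S m) p q ->
  exists mu, forall k lam, (k <= m)%nat ->
  is_control_points m B (fun t => Rpower t (r k)) lam -> q (r k) = mu * lam i.
Proof.
  intros Hi Hp Hq N. destruct hB as (HE & _ & _ & _ & HZ).
  destruct (finite_choice (nat -> R) (fun _ => 0)
    (fun l c => forall t, 0 < t -> B l t = sum_f_R0 (fun j => c j * Rpower t (r j)) m) m HE)
    as (C & HC).
  set (L := fun l => sum_f_R0 (fun j => C l j * q (r j)) m).
  (* For l < i the zero of order m - l at 1 exceeds the degree of [q]; for l > i the zero of order l
     at [a] exceeds the degree of [p], and interpolation exchanges the two expressions of the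
     functional. *)
  assert (HL : forall l, (l <= m)%nat -> l <> i -> L l = 0).
  { intros l Hl Hli. destruct (HZ l Hl) as ((Za & _) & (Z1 & _)).
    destruct (Nat.lt_total l i) as [Hlt|[->|Hlt]]; [|contradiction|].
    - rewrite <- (jet_vanishes_poly _ q (C l) r m (B l) 1 Hq Rlt_0_1 (HC l Hl)).
      + apply sum_eq. intros j _. unfold Rpower. rewrite ln_1, Rmult_0_r, exp_0. ring.
      + intros j h Hj. apply Z1. lia.
    - rewrite <- (jet_vanishes_poly _ p (C l) r m (B l) a Hp ha (HC l Hl)).
      + apply sum_eq. intros j Hj. rewrite (N j) by lia. unfold Rpower.
        now replace (- - ln a * r j) with (r j * ln a) by ring.
      + intros j h Hj. apply Za. lia. }
  exists (L i). intros k lam Hk HP.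
  (* The coefficients of t^(r_k) minus the sum of the lam_l B_l, which is the zero function.
     Applying the functional to it gives q (r_k) as the sum of the lam_l L_l. *)
  set (e := fun j => (if Nat.eq_dec j k then 1 else 0) - sum_f_R0 (fun l => lam l * C l j) m).
  assert (E : sum_f_R0 (fun j => e j * (q (r j) * Rpower 1 (r j))) m = 0).
  { apply (jet_vanishes_poly _ q e r m (fun _ => 0) 1 Hq Rlt_0_1).
    - intros t Ht. unfold e.
      rewrite (sum_eq _ (fun j => (if Nat.eq_dec j k then 1 else 0) * Rpower t (r j)
        - sum_f_R0 (fun l => lam l * C l j * Rpower t (r j)) m)).
      + rewrite minus_sum, sum_f_R0_swap, (sum_f_R0_single _ m k Hk).
        * destruct (Nat.eq_dec k k) as [_|]; [|contradiction].
          rewrite (sum_eq _ (fun l => B l t * lam l)).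
          -- rewrite <- HP by exact Ht. ring.
          -- intros l Hl. rewrite (HC l Hl t Ht), Rmult_comm, scal_sum.
             apply sum_eq. intros; ring.
        * intros j _ Hj. destruct (Nat.eq_dec j k); [contradiction|ring].
      + intros j _. rewrite Rmult_minus_distr_r. f_equal.
        rewrite Rmult_comm, scal_sum. reflexivity.
    - intros j h _ Hh. apply (nth_derive_zero _ _ _ Hh); [auto|lra]. }
  assert (E' : sum_f_R0 (fun j => e j * (q (r j) * Rpower 1 (r j))) m = q (r k) - L i * lam i).
  { rewrite (sum_eq _ (fun j => (if Nat.eq_dec j k then 1 else 0) * q (r j)
        - sum_f_R0 (fun l => lam l * C l j * q (r j)) m)).
    - rewrite minus_sum, sum_f_R0_swap, (sum_f_R0_single _ m k Hk).
      + destruct (Nat.eq_dec k k) as [_|]; [|contradiction].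
        rewrite Rmult_1_l. f_equal.
        rewrite (sum_eq _ (fun l => L l * lam l)).
        * apply (sum_f_R0_single (fun l => L l * lam l)); [exact Hi|].
          intros l Hl Hli. rewrite HL by assumption. ring.
        * intros l _. unfold L. rewrite Rmult_comm, scal_sum. apply sum_eq. intros; ring.
      + intros j _ Hj. destruct (Nat.eq_dec j k); [contradiction|ring].
    - intros j _. unfold e. replace (Rpower 1 (r j)) with 1.
      + rewrite Rmult_1_r, Rmult_minus_distr_r. f_equal.
        rewrite Rmult_comm, scal_sum. reflexivity.
      + unfold Rpower. rewrite ln_1, Rmult_0_r, exp_0. reflexivity. }
  lra.
Qed.

(** The factor [mu] is found from the constant 1 = t^(r_0): all its control points are 1 by
    partition of unity, and q 0 = 1, so [mu] = 1. *)
Lemma control_point_normalized r (hr0 : r 0%nat = 0) m a (ha : 0 < a) B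
  (hB : is_CB_basis r m a 1 B) i p q k lam : (i <= m)%nat -> (k <= m)%nat ->
  normalized_pair r m (- ln a) (S m) (S i) p q ->
  is_control_points m B (fun t => Rpower t (r k)) lam -> lam i = q (r k).
Proof.
  intros Hi Hk (Hp & Hq & N & _ & _ & _ & E1) HP.
  destruct (control_point_value r m a ha B hB i p q Hi Hp Hq N) as (mu & Hmu).
  rewrite Nat.sub_diag in E1.
  rewrite (Hmu 0%nat (fun _ => 1)) in E1.
  - rewrite (Hmu k lam Hk HP). rewrite Rmult_1_r in E1. rewrite E1. ring.
  - lia.
  - intros t Ht. destruct hB as (_ & _ & _ & H1 & _).
    rewrite hr0, Rpower_O by exact Ht. rewrite (sum_eq _ (fun j => B j t)) by (intros; ring).
    symmetry. now apply H1.
Qed.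

(** * Nonnegativity of the basis on [a, 1] *)

Lemma poly_lt_sum n (f : nat -> R -> R) m : (forall j, (j <= m)%nat -> poly_lt n (f j)) ->
  poly_lt n (fun x => sum_f_R0 (fun j => f j x) m).
Proof.
  induction m as [|m IH]; intro H; simpl; [apply (H 0%nat); lia|].
  eapply poly_lt_ext.
  - apply (poly_lt_lin n 1 1); [apply IH; intros; apply H; lia|apply (H (S m)); lia].
  - intro x; cbv beta; ring.
Qed.

Lemma lead_sum n (l : nat -> R) (f : nat -> R -> R) m :
  (forall j, (j <= m)%nat -> lead n (l j) (f j)) ->
  lead n (sum_f_R0 l m) (fun x => sum_f_R0 (fun j => f j x) m).
Proof.
  intro H. apply (poly_lt_ext _ _ _ (poly_lt_sum n _ m H)).
  intro x; cbv beta. rewrite minus_sum. f_equal. rewrite Rmult_comm, scal_sum. apply sum_eq. intros; ring.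
Qed.

(** Applied with b_j = B_j (exp (- s)). At the nodes, q_j may be traded for p_j exp (- A x); doing
    so for j < i isolates b_i in the leading coefficient of the rest, and the sign lemma with c = 1
    applies. *)
Lemma coefficient_nonneg r (hinc : forall n, r n < r (S n)) m A (HA : 0 < A) s (Hs : 0 <= s <= A)
  (b : nat -> R) (p q : nat -> R -> R) :
  (forall j, (j <= m)%nat -> normalized_pair r m A (S m) (S j) (p j) (q j)) ->
  (forall k, (k <= m)%nat -> exp (- s * r k) = sum_f_R0 (fun j => b j * q j (r k)) m) ->
  forall i, (i <= m)%nat -> 0 <= b i.
Proof.
  intros HN Hb i Hi.
  destruct (HN i Hi) as (_ & _ & _ & _ & (l & Hl & Li) & _ & _). simpl in Li.
  set (Q := fun j x => if lt_dec j i then 0 else b j * q j x).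
  set (P := fun j x => if lt_dec j i then - b j * p j x else 0).
  (* Only j = i contributes in degree m - i, since q_j has degree at most m - j. *)
  assert (HQ : lead (m - i) (sum_f_R0 (fun j => if Nat.eq_dec j i then b i * ((-1) ^ (m - i) * l) else 0) m)
                 (fun x => sum_f_R0 (fun j => Q j x) m)).
  { apply lead_sum. intros j Hj. unfold Q.
    destruct (Nat.eq_dec j i) as [->|Hji]; destruct (lt_dec _ i) as [Hlt|Hge]; try lia.
    - apply (lead_ext _ _ (fun x => b i * q i x + 0 * q i x)); [|intro; ring].
      pose proof (lead_lin _ (b i) 0 _ _ _ _ Li Li) as H.
      rewrite Rmult_0_l, Rplus_0_r in H. exact H.
    - apply poly_lt_lead, poly_lt_0.
    - apply poly_lt_lead. destruct (HN j Hj) as (_ & Hq & _).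
      apply (poly_lt_le (S (S m) - S j)); [lia|].
      apply (poly_lt_ext _ (fun x => b j * q j x + 0 * q j x)); [|intro; ring].
      now apply poly_lt_lin. }
  rewrite (sum_f_R0_single _ m i Hi) in HQ.
  2: { intros j _ Hj. destruct (Nat.eq_dec j i); [contradiction|reflexivity]. }
  destruct (Nat.eq_dec i i) as [_|]; [|contradiction].
  assert (HP : poly_lt i (fun x => sum_f_R0 (fun j => P j x) m)).
  { apply poly_lt_sum. intros j Hj. unfold P. destruct (lt_dec j i) as [Hlt|_]; [|apply poly_lt_0].
    destruct (HN j Hj) as (Hp & _). apply (poly_lt_le (S j)); [lia|].
    apply (poly_lt_ext _ (fun x => - b j * p j x + 0 * p j x)); [|intro; ring].
    now apply poly_lt_lin. }
  destruct (lead_sign_exp2 A s HA Hs (m - i) i _ _ _ 1 (r 0%nat - 1) HQ HP) as (K & HK & E).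
  - apply (node_zeros r hinc m); [lia| |].
    + intros k Hk _. rewrite (Hb k Hk).
      rewrite Rmult_1_l, (Rmult_comm (sum_f_R0 (fun j => P j (r k)) m)), scal_sum, <- !minus_sum.
      rewrite (sum_eq _ (fun _ => 0)); [rewrite sum_cte; ring|].
      intros j Hj. unfold Q, P. destruct (HN j Hj) as (_ & _ & N & _).
      destruct (lt_dec j i); [|ring]. rewrite (N k) by lia. ring.
    + replace (S m - S (m - i + i))%nat with 0%nat by lia. lra.
  - rewrite Rmult_1_r in E.
    replace (b i * ((-1) ^ (m - i) * l) * (-1) ^ (m - i))
      with ((-1) ^ (m - i) * (-1) ^ (m - i) * (b i * l)) in E by ring.
    rewrite pow_m1_sq, Rmult_1_l in E. apply (Rmult_le_reg_r l); lra.
Qed.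

(** * Upper bound: convexity of the control polygon *)

(** Nondecreasing edge slopes give a supporting line at every vertex. The slopes [g] are given
    separately because an edge may be degenerate, with c = 0. *)
Lemma convex_polygon_support (x y g : nat -> R) m :
  (forall j, (j < m)%nat -> exists c, 0 <= c /\ x (S j) - x j = c /\ y (S j) - y j = c * g j) ->
  (forall j, (S j < m)%nat -> g j <= g (S j)) ->
  forall i, (i <= m)%nat -> exists sg, forall j, (j <= m)%nat -> sg * (x j - x i) <= y j - y i.
Proof.
  intros Hs Hg i Hi.
  assert (Mono : forall j l, (j <= l)%nat -> (l < m)%nat -> g j <= g l).
  { intros j l Hjl. induction Hjl as [|l Hjl IH]; intro Hl; [lra|].
    apply Rle_trans with (g l); [apply IH; lia|now apply Hg]. }
  assert (Hsg : exists sg, (forall j, (i <= j)%nat -> (j < m)%nat -> sg <= g j) /\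
                           (forall j, (j < i)%nat -> g j <= sg)).
  (* The slope of the edge to the right of the vertex, or of the edge to its left at the last
     vertex. *)
  { destruct (Nat.eq_dec i m) as [->|N].
    - exists (g (m - 1)%nat). split; [intros; lia|]. intros; apply Mono; lia.
    - exists (g i). split; intros; apply Mono; lia. }
  destruct Hsg as (sg & Hup & Hdown). exists sg.
  assert (Step : forall j, (j < m)%nat -> exists c, 0 <= c /\
            (y (S j) - sg * x (S j)) - (y j - sg * x j) = c * (g j - sg)).
  { intros j Hj. destruct (Hs j Hj) as (c & Hc & E1 & E2). exists c. split; [exact Hc|].
    replace (x (S j)) with (x j + c) by lra. replace (y (S j)) with (y j + c * g j) by lra. ring. }
  assert (Up : forall j, (i <= j)%nat -> (j <= m)%nat -> y i - sg * x i <= y j - sg * x j).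
  { induction 1 as [|j Hij IH]; intro Hj; [lra|].
    destruct (Step j Hj) as (c & Hc & E). specialize (Hup j Hij Hj).
    pose proof (Rmult_le_pos c (g j - sg) Hc ltac:(lra)). specialize (IH ltac:(lia)). lra. }
  assert (Down : forall j, (j <= i)%nat -> y i - sg * x i <= y (i - j)%nat - sg * x (i - j)%nat).
  { induction j as [|j IH]; intro Hj; [rewrite Nat.sub_0_r; lra|].
    destruct (Step (i - S j)%nat ltac:(lia)) as (c & Hc & E).
    specialize (Hdown (i - S j)%nat ltac:(lia)).
    pose proof (Rmult_le_pos c (sg - g (i - S j)%nat) Hc ltac:(lra)).
    specialize (IH ltac:(lia)). replace (S (i - S j)) with (i - j)%nat in E by lia. lra. }
  intros j Hj. destruct (le_lt_dec i j) as [L|L].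
  - specialize (Up j L Hj). lra.
  - specialize (Down (i - j)%nat ltac:(lia)). replace (i - (i - j))%nat with j in Down by lia. lra.
Qed.

Lemma step_monotone (x : nat -> R) m :
  (forall j, (j < m)%nat -> x j <= x (S j)) -> forall j l, (j <= l)%nat -> (l <= m)%nat -> x j <= x l.
Proof.
  intros H j l Hjl. induction Hjl as [|l Hjl IH]; intro Hl; [lra|].
  apply Rle_trans with (x l); [apply IH; lia|apply H; lia].
Qed.

(** The curve point with the same abscissa as vertex [i] is a convex combination of the vertices,
    hence lies above the supporting line at [i], which passes through that vertex. *)
Lemma control_point_upper r (hr0 : r 0%nat = 0) (hinc : forall n, r n < r (S n))
  m A (HA : 0 < A) k (Hk : (1 <= k <= m)%nat) (p q : nat -> R -> R) :
  (forall j, (j <= m)%nat -> normalized_pair r m A (S m) (S j) (p j) (q j)) ->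
  (forall s, 0 <= s <= A -> exists b, forall l, (l <= m)%nat ->
     exp (- s * r l) = sum_f_R0 (fun j => b j * q j (r l)) m) ->
  forall i, (i <= m)%nat -> exists s, q i (r 1%nat) = exp (- s * r 1%nat) /\
    q i (r k) <= exp (- s * r k).
Proof.
  intros HN Hb i Hi.
  assert (H1 : 0 < r 1%nat) by (rewrite <- hr0; apply hinc).
  assert (H1k : r 1%nat <= r k) by (apply increasing_le; [exact hinc|lia]).
  destruct (finite_choice ((R -> R) * (R -> R)) (fun _ => 0, fun _ => 0)
    (fun j t => normalized_pair r m A m (S j) (fst t) (snd t)) (m - 1)) as (pq & Hpq).
  { intros j Hj. destruct (normalized_pair_exists r hinc m A HA m (S j) ltac:(lia) ltac:(lia))
      as (p' & q' & H'). now exists (p', q'). }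
  (* Edge slopes: the difference of consecutive q_j is c x times a polynomial equal to 1 at r_1, so
     the increments at r_k and r_1 have this ratio. *)
  set (g := fun j => r k / r 1%nat * snd (pq j) (r k)).
  assert (Step : forall j, (j < m)%nat -> exists c, 0 <= c /\
            q (S j) (r 1%nat) - q j (r 1%nat) = c /\ q (S j) (r k) - q j (r k) = c * g j).
  { intros j Hj. pose proof (Hpq j ltac:(lia)) as H'.
    destruct (normalized_pair_step r hinc m A HA m (S j) _ _ _ _ _ _ (le_n m) ltac:(lia)
      (HN j ltac:(lia)) (HN (S j) ltac:(lia)) H') as (c & Hc & E).
    destruct H' as (_ & _ & _ & _ & _ & _ & E1). replace (S m - m)%nat with 1%nat in E1 by lia.
    rewrite Nat.sub_diag, hr0 in E.
    exists (c * r 1%nat). split; [apply Rmult_le_pos; lra|]. rewrite !E, E1. split; [ring|].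
    unfold g. field. lra. }
  destruct (convex_polygon_support _ _ g m Step) with (i := i) as (sg & Hsg); [|exact Hi|].
  (* Convexity is the step lemma used once more, now on the nodes from r_1 on. *)
  { intros j Hj.
    destruct m as [|m']; [lia|].
    destruct (normalized_pair_exists r hinc (S m') A HA m' (S j) ltac:(lia) ltac:(lia))
      as (p0 & q0 & H0).
    destruct (normalized_pair_step r hinc (S m') A HA m' (S j) _ _ _ _ _ _ ltac:(lia) ltac:(lia)
      (Hpq j ltac:(lia)) (Hpq (S j) ltac:(lia)) H0) as (c & Hc & E).
    destruct H0 as (_ & _ & _ & _ & _ & C & _).
    pose proof (node_cone_nonneg r hinc (S m') q0 k ltac:(lia) C) as Hq0.
    specialize (E (r k)). replace (S m' - m')%nat with 1%nat in E by lia.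
    unfold g. apply Rmult_le_compat_l.
    - apply Rle_mult_inv_pos; lra.
    - assert (0 <= c * (r k - r 1%nat) * q0 (r k)); [|lra].
      repeat apply Rmult_le_pos; lra. }
  assert (Mono : forall j l, (j <= l)%nat -> (l <= m)%nat -> q j (r 1%nat) <= q l (r 1%nat)).
  { apply step_monotone. intros j Hj. destruct (Step j Hj) as (c & Hc & E & _). lra. }
  (* At the end indices [p] or [q] is the constant 1, so the abscissas run from exp (- A r_1) to 1
     and the parameter [s] below falls in [0, A]. *)
  assert (X0 : q 0%nat (r 1%nat) = exp (- A * r 1%nat)).
  { destruct (HN 0%nat ltac:(lia)) as ((c & h & Hh & Ep) & _ & N & _ & _ & _ & E).
    rewrite Nat.sub_diag in E. rewrite (N 0%nat) in E by lia. rewrite (N 1%nat) by lia.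
    rewrite Ep, Hh, Rmult_0_r in E |- *. rewrite hr0, Rmult_0_r, exp_0 in E.
    replace (c + 0) with 1 by lra. ring. }
  assert (Xm : q m (r 1%nat) = 1).
  { destruct (HN m ltac:(lia)) as (_ & Hq & _ & _ & _ & _ & E).
    rewrite Nat.sub_diag in E. replace (S (S m) - S m)%nat with 1%nat in Hq by lia.
    destruct Hq as (c & h & Hh & Eq). rewrite Eq, Hh in E |- *. lra. }
  pose proof (Mono 0%nat i ltac:(lia) Hi) as L0. pose proof (Mono i m Hi ltac:(lia)) as L1.
  rewrite X0 in L0. rewrite Xm in L1. pose proof (exp_pos (- A * r 1%nat)) as Hpos.
  set (X := q i (r 1%nat)) in *. set (s := - ln X / r 1%nat).
  assert (EX : exp (- s * r 1%nat) = X).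
  { unfold s. replace (- (- ln X / r 1%nat) * r 1%nat) with (ln X) by (field; lra).
    apply exp_ln. lra. }
  assert (Hs : 0 <= s <= A).
  { unfold s. split.
    - apply Rle_mult_inv_pos; [|exact H1].
      destruct (Rle_lt_or_eq_dec _ _ L1) as [L| ->]; [|rewrite ln_1; lra].
      pose proof (ln_increasing X 1 ltac:(lra) L). rewrite ln_1 in *. lra.
    - apply (Rmult_le_reg_r (r 1%nat)); [exact H1|].
      replace (- ln X / r 1%nat * r 1%nat) with (- ln X) by (field; lra).
      assert (- A * r 1%nat <= ln X); [|lra].
      rewrite <- (ln_exp (- A * r 1%nat)).
      destruct (Rle_lt_or_eq_dec _ _ L0) as [L| <-]; [|lra].
      apply Rlt_le, ln_increasing; lra. }
  exists s. split; [now symmetry|].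
  destruct (Hb s Hs) as (b & Eb).
  pose proof (coefficient_nonneg r hinc m A HA s Hs b p q HN Eb) as Hbn.
  assert (B1 : sum_f_R0 b m = 1).
  { pose proof (Eb 0%nat ltac:(lia)) as E. rewrite hr0, Rmult_0_r, exp_0 in E. rewrite E.
    apply sum_eq. intros j Hj. destruct (HN j Hj) as (_ & _ & _ & _ & _ & _ & E1).
    rewrite Nat.sub_diag, hr0 in E1. rewrite E1. ring. }
  assert (S0 : 0 <= sum_f_R0 (fun j => b j * ((q j (r k) - q i (r k)) - sg * (q j (r 1%nat) - X))) m).
  { rewrite <- (Rmult_0_l (INR (S m))), <- sum_cte. apply sum_Rle.
    intros j Hj. apply Rmult_le_pos; [now apply Hbn|]. specialize (Hsg j Hj). fold X in Hsg. lra. }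
  rewrite (sum_eq _ (fun j => (b j * q j (r k) - b j * q i (r k))
             - (b j * q j (r 1%nat) * sg - b j * (sg * X)))) in S0 by (intros; ring).
  rewrite !minus_sum, <- !scal_sum, <- !Eb, B1, EX in S0 by lia. lra.
Qed.

(** * Lower bound: Jensen's inequality over the cone of node products *)

(** Bernoulli's inequality: the tangent at 1 to the convex function z^kap, evaluated at z = exp
    w. *)
Lemma exp_tangent kap w : 1 <= kap -> 1 + kap * (exp w - 1) <= exp (kap * w).
Proof.
  intro Hk. set (z := exp (kap * w)). assert (Hz : 0 < z) by apply exp_pos.
  set (s := 1 + (z - 1) / kap).
  assert (Hs : 0 < s).
  { unfold s. replace (1 + (z - 1) / kap) with ((kap - 1 + z) / kap) by (field; lra).
    apply Rdiv_lt_0_compat; lra. }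
  (* weighted AM-GM for [1] and [z]: add up [exp u >= 1 + u] at the two deviations from [ln s] *)
  pose proof (exp_ineq1_le (- ln s)) as I1. pose proof (exp_ineq1_le (kap * w - ln s)) as I2.
  replace (kap * w - ln s) with (kap * w + - ln s) in I2 by ring.
  rewrite exp_plus in I2. fold z in I2. rewrite exp_Ropp, exp_ln in I1, I2 by exact Hs.
  assert (L : w <= ln s).
  { assert ((kap - 1) * (1 + - ln s) + (1 + (kap * w + - ln s)) <= (kap - 1) * / s + z * / s).
    { apply Rplus_le_compat; [apply Rmult_le_compat_l; lra|exact I2]. }
    replace ((kap - 1) * / s + z * / s) with kap in H.
    - apply (Rmult_le_reg_l kap); lra.
    - unfold s. field. split; [|lra]. lra. }
  assert (exp w <= s).
  { rewrite <- (exp_ln s Hs). destruct L as [L|L]; [now apply Rlt_le, exp_increasing|rewrite L; lra]. }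
  apply (Rmult_le_compat_l kap) in H; [|lra]. unfold s in H.
  replace (kap * (1 + (z - 1) / kap)) with (kap + z - 1) in H by (field; lra). lra.
Qed.

(** The sum starts at r_1 because r_0 = 0. The difference of its values at m and m - d runs over the
    nodes of [node_prod r m d]. *)
Fixpoint inv_sum (r : nat -> R) (n : nat) : R :=
  match n with O => 0 | S n => inv_sum r n + / r (S n) end.

Lemma inv_sum_succ r n : inv_sum r (S n) = sum_f_R0 (fun i => / r (S i)) n.
Proof. induction n as [|n IH]; [simpl; ring|]. simpl in *. now rewrite IH. Qed.

Lemma positive_node r (hr0 : r 0%nat = 0) (hinc : forall n, r n < r (S n)) j :
  (1 <= j)%nat -> 0 < r j.
Proof. intro H. rewrite <- hr0. apply increasing_lt; [exact hinc|lia]. Qed.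

Lemma inv_sum_mono r (hr0 : r 0%nat = 0) (hinc : forall n, r n < r (S n)) i j :
  (i <= j)%nat -> inv_sum r i <= inv_sum r j.
Proof.
  induction 1 as [|j H IH]; [lra|]. simpl.
  pose proof (Rinv_0_lt_compat _ (positive_node r hr0 hinc (S j) ltac:(lia))). lra.
Qed.

Lemma inv_sum_pred r m d : (S d <= m)%nat ->
  inv_sum r (m - d) = inv_sum r (m - S d) + / r (m - d)%nat.
Proof. intro H. replace (m - d)%nat with (S (m - S d)) by lia. reflexivity. Qed.

Lemma node_prod_0_pos r (hr0 : r 0%nat = 0) (hinc : forall n, r n < r (S n)) m d :
  (d <= m)%nat -> 0 < node_prod r m d 0.
Proof.
  induction d as [|d IH]; intro H; simpl; [lra|].
  rewrite Rminus_0_r. apply Rmult_lt_0_compat; [apply IH; lia|].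
  apply positive_node; auto. lia.
Qed.

(** Factor by factor, 1 - y <= exp (- y) with y = r_1 / r_l. *)
Lemma node_prod_upper r (hr0 : r 0%nat = 0) (hinc : forall n, r n < r (S n)) m d :
  (d <= m)%nat -> node_prod r m d (r 1%nat) <=
    exp (- (r 1%nat * (inv_sum r m - inv_sum r (m - d)))) * node_prod r m d 0.
Proof.
  induction d as [|d IH]; intro H.
  - rewrite Nat.sub_0_r, Rminus_diag, Rmult_0_r, Ropp_0, exp_0. simpl. lra.
  - pose proof (IH ltac:(lia)) as IH'. pose proof (inv_sum_pred r m d H) as E.
    set (c := r (m - d)%nat) in *.
    assert (Hc : 0 < c) by (apply positive_node; auto; lia).
    replace (- (r 1%nat * (inv_sum r m - inv_sum r (m - S d)))) with
      (- (r 1%nat * (inv_sum r m - inv_sum r (m - d))) + - (r 1%nat * / c)) by (rewrite E; ring).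
    rewrite exp_plus. simpl. fold c. rewrite Rminus_0_r.
    replace (exp (- (r 1%nat * (inv_sum r m - inv_sum r (m - d)))) * exp (- (r 1%nat * / c)) *
      (node_prod r m d 0 * c)) with
      (exp (- (r 1%nat * (inv_sum r m - inv_sum r (m - d)))) * node_prod r m d 0 *
       (exp (- (r 1%nat * / c)) * c)) by ring.
    apply Rmult_le_compat; auto.
    + apply node_prod_nonneg; [exact hinc|lia|lia].
    + pose proof (increasing_le r hinc 1 (m - d) ltac:(lia)). unfold c. lra.
    + pose proof (exp_ineq1_le (- (r 1%nat * / c))) as I.
      apply (Rmult_le_compat_r c) in I; [|lra].
      replace ((1 + - (r 1%nat * / c)) * c) with (c - r 1%nat) in I by (field; lra). exact I.
Qed.

(** For y = x / r_l with (1 + dl) y <= dl, one has (1 + (1 + dl) y) (1 - y) >= 1, hence 1 - y >= exp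
    (- (1 + dl) y). *)
Lemma node_prod_lower r (hr0 : r 0%nat = 0) (hinc : forall n, r n < r (S n)) m d x dl :
  0 < x -> 0 < dl -> (d <= m)%nat ->
  (forall j, (m < j + d)%nat -> x * (1 + dl) <= dl * r j) ->
  exp (- ((1 + dl) * (x * (inv_sum r m - inv_sum r (m - d))))) * node_prod r m d 0
    <= node_prod r m d x.
Proof.
  intros Hx Hdl. induction d as [|d IH]; intros H Hj.
  - rewrite Nat.sub_0_r, Rminus_diag, !Rmult_0_r, Ropp_0, exp_0. simpl. lra.
  - assert (IH' := IH ltac:(lia) ltac:(intros; apply Hj; lia)). clear IH.
    pose proof (inv_sum_pred r m d H) as E. specialize (Hj (m - d)%nat ltac:(lia)).
    set (c := r (m - d)%nat) in *.
    assert (Hc : 0 < c) by (apply positive_node; auto; lia).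
    assert (Hi : 0 < / c) by now apply Rinv_0_lt_compat.
    set (y := x * / c). assert (Hy : 0 < y) by now apply Rmult_lt_0_compat.
    assert (Ey : y * (1 + dl) <= dl).
    { unfold y. apply (Rmult_le_reg_r c); [exact Hc|].
      replace (x * / c * (1 + dl) * c) with (x * (1 + dl)) by (field; lra). exact Hj. }
    replace (- ((1 + dl) * (x * (inv_sum r m - inv_sum r (m - S d))))) with
      (- ((1 + dl) * (x * (inv_sum r m - inv_sum r (m - d)))) + - ((1 + dl) * y)) by (rewrite E; unfold y; ring).
    rewrite exp_plus. simpl. fold c. rewrite Rminus_0_r.
    replace (exp (- ((1 + dl) * (x * (inv_sum r m - inv_sum r (m - d))))) * exp (- ((1 + dl) * y)) *
      (node_prod r m d 0 * c)) with
      (exp (- ((1 + dl) * (x * (inv_sum r m - inv_sum r (m - d))))) * node_prod r m d 0 *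
       (exp (- ((1 + dl) * y)) * c)) by ring.
    replace (c - x) with ((1 - y) * c) by (unfold y; field; lra).
    apply Rmult_le_compat; auto.
    + apply Rmult_le_pos; [apply Rlt_le, exp_pos|].
      apply Rlt_le, node_prod_0_pos; auto. lia.
    + apply Rmult_le_pos; [apply Rlt_le, exp_pos|lra].
    + apply Rmult_le_compat_r; [lra|].
      rewrite exp_Ropp. pose proof (exp_ineq1_le ((1 + dl) * y)) as I.
      apply (Rmult_le_reg_l (exp ((1 + dl) * y))); [apply exp_pos|].
      rewrite Rinv_r by apply Rgt_not_eq, exp_pos.
      apply Rle_trans with ((1 + (1 + dl) * y) * (1 - y)); [nra|].
      apply Rmult_le_compat_r; [nra|exact I].
Qed.

(** The loss is at most dl s exp (- s), and s exp (- s) <= 1, so the bound is uniform in [s]. *)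
Lemma exp_dilation_bound s dl : 0 <= s -> 0 <= dl -> exp (- s) - dl <= exp (- ((1 + dl) * s)).
Proof.
  intros Hs Hd. replace (- ((1 + dl) * s)) with (- s + - (dl * s)) by ring. rewrite exp_plus.
  pose proof (exp_ineq1_le (- (dl * s))) as I1. pose proof (exp_ineq1_le s) as I2.
  pose proof (exp_pos (- s)) as P.
  assert (P1 : exp (- s) * s <= 1).
  { assert (E : exp (- s) * exp s = 1) by (rewrite <- exp_plus, Rplus_opp_l; apply exp_0).
    pose proof (Rmult_le_compat_l _ _ _ (Rlt_le _ _ P) I2). lra. }
  apply (Rmult_le_compat_l (exp (- s))) in I1; [|lra]. nra.
Qed.

(* This is where the Muentz condition enters: it handles the products reaching down to small nodes. *)
Lemma node_prod_asymptotic r (hr0 : r 0%nat = 0) (hinc : forall n, r n < r (S n))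
  (hinf : cv_infty r) (hdiv : cv_infty (fun n => sum_f_R0 (fun i => / r (S i)) n))
  k (hk : (1 <= k)%nat) eps (Heps : 0 < eps) :
  exists N, forall m d, (N <= m)%nat -> (d <= m)%nat ->
  (exp (- (r k * (inv_sum r m - inv_sum r (m - d)))) - eps) * node_prod r m d 0
    <= node_prod r m d (r k).
Proof.
  assert (Hrk := positive_node r hr0 hinc k hk).
  (* Past [J] every node is large enough for [node_prod_lower] with dl = eps. A product reaching
     below [J] has, for large [m], a reciprocal sum so big that the left side is nonpositive. *)
  destruct (hinf (r k * (1 + eps) / eps)) as (J & HJ).
  destruct (hdiv (inv_sum r J + - ln eps / r k)) as (N & HN).
  exists (S (N + k)). intros m d Hm Hd.
  pose proof (node_prod_0_pos r hr0 hinc m d Hd) as P0.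
  destruct (le_lt_dec J (m - d)) as [L|L].
  - eapply Rle_trans; [|apply (node_prod_lower r hr0 hinc m d (r k) eps); auto].
    + apply Rmult_le_compat_r; [lra|]. apply exp_dilation_bound; [|lra].
      apply Rmult_le_pos; [lra|].
      pose proof (inv_sum_mono r hr0 hinc (m - d) m ltac:(lia)). lra.
    + intros j Hj. specialize (HJ j ltac:(lia)).
      apply Rlt_le in HJ. apply (Rmult_le_compat_l eps) in HJ; [|lra].
      replace (eps * (r k * (1 + eps) / eps)) with (r k * (1 + eps)) in HJ by (field; lra). exact HJ.
  - apply Rle_trans with 0; [|apply node_prod_nonneg; [exact hinc|lia|lia]].
    assert (I : exp (- (r k * (inv_sum r m - inv_sum r (m - d)))) <= eps).
    { rewrite <- (exp_ln eps Heps). apply Rlt_le, exp_increasing.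
      specialize (HN (m - 1)%nat ltac:(lia)). rewrite <- inv_sum_succ in HN.
      replace (S (m - 1)) with m in HN by lia.
      pose proof (inv_sum_mono r hr0 hinc (m - d) J ltac:(lia)).
      assert (G : - ln eps / r k < inv_sum r m - inv_sum r (m - d)) by lra.
      apply (Rmult_lt_compat_l (r k)) in G; [|exact Hrk].
      replace (r k * (- ln eps / r k)) with (- ln eps) in G by (field; lra). lra. }
    nra.
Qed.

(** The claim is linear in [f], so node products suffice; for them it is the tangent to x^(r_k /
    r_1) at x = exp (- s r_1). When f 0 = 1 and f (r_1) = exp (- s r_1), the slope term vanishes. *)
Lemma node_cone_jensen r (hr0 : r 0%nat = 0) (hinc : forall n, r n < r (S n)) m k s eps f :
  (1 <= k <= m)%nat ->
  (forall d, (d <= m)%nat ->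
    (exp (- (r k * (inv_sum r m - inv_sum r (m - d)))) - eps) * node_prod r m d 0
      <= node_prod r m d (r k)) ->
  node_cone r m f ->
  (exp (- s * r k) - eps) * f 0 +
    r k / r 1%nat * exp (- s * (r k - r 1%nat)) * (f (r 1%nat) - exp (- s * r 1%nat) * f 0) <= f (r k).
Proof.
  intros Hk Hd C.
  assert (H1 := positive_node r hr0 hinc 1 ltac:(lia)).
  assert (H1k := increasing_le r hinc 1 k ltac:(lia)).
  assert (Hkap : 1 <= r k / r 1%nat).
  { apply (Rmult_le_reg_r (r 1%nat)); [exact H1|].
    replace (r k / r 1%nat * r 1%nat) with (r k) by (field; lra). lra. }
  (* The slope of that tangent; being nonnegative, it preserves the upper bound on the value at
     r_1. *)
  set (sl := r k / r 1%nat * exp (- s * (r k - r 1%nat))).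
  assert (Hsl : 0 <= sl) by (apply Rmult_le_pos; [lra|apply Rlt_le, exp_pos]).
  induction C as [w d f Hw Hdm E|f g h _ IHf _ IHg E].
  - rewrite !E.
    assert (G : (exp (- s * r k) - eps) * node_prod r m d 0 +
              sl * (node_prod r m d (r 1%nat) - exp (- s * r 1%nat) * node_prod r m d 0)
              <= node_prod r m d (r k)).
    { destruct (Nat.eq_dec d (S m)) as [->|N].
      - pose proof (node_prod_zero r m (S m) 0 ltac:(lia) ltac:(lia)) as Z0. rewrite hr0 in Z0.
        rewrite Z0, !node_prod_zero by lia. lra.
      - pose proof (Hd d ltac:(lia)) as Lk.
        pose proof (node_prod_upper r hr0 hinc m d ltac:(lia)) as L1.
        pose proof (node_prod_0_pos r hr0 hinc m d ltac:(lia)) as P0.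
        set (T := inv_sum r m - inv_sum r (m - d)) in *.
        pose proof (exp_tangent (r k / r 1%nat) (r 1%nat * (s - T)) Hkap) as I.
        replace (r k / r 1%nat * (r 1%nat * (s - T))) with (- (r k * T) - (- s * r k)) in I
          by (field; lra).
        replace (r 1%nat * (s - T)) with (- (r 1%nat * T) - (- s * r 1%nat)) in I by ring.
        apply (Rmult_le_compat_l (exp (- s * r k))) in I; [|apply Rlt_le, exp_pos].
        rewrite <- exp_plus in I.
        replace (- s * r k + (- (r k * T) - - s * r k)) with (- (r k * T)) in I by ring.
        assert (I' : exp (- s * r k) + sl * (exp (- (r 1%nat * T)) - exp (- s * r 1%nat))
                     <= exp (- (r k * T))).
        { eapply Rle_trans; [|exact I]. apply Req_le. unfold sl.
          rewrite Rmult_plus_distr_l, Rmult_1_r. f_equal.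
          replace (exp (- s * r k)) with (exp (- s * (r k - r 1%nat)) * exp (- s * r 1%nat))
            by (rewrite <- exp_plus; f_equal; ring).
          replace (exp (- (r 1%nat * T)))
            with (exp (- s * r 1%nat) * exp (- (r 1%nat * T) - - s * r 1%nat))
            by (rewrite <- exp_plus; f_equal; ring).
          ring. }
        eapply Rle_trans; [|exact Lk].
        apply (Rmult_le_compat_r (node_prod r m d 0)) in I'; [|lra].
        apply (Rmult_le_compat_l sl) in L1; [|exact Hsl]. lra. }
    apply (Rmult_le_compat_l w) in G; [|exact Hw]. lra.
  - rewrite !E. lra.
Qed.

(** * Combining the two bounds *)

Lemma max_upto_bound m g e : 0 <= e -> (forall i, (i <= m)%nat -> g i <= e) ->
  0 <= max_upto m g <= e.
Proof.
  intros He H. unfold max_upto.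
  assert (G : forall l, (forall i, In i l -> g i <= e) -> 0 <= fold_right Rmax 0 (map g l) <= e).
  { induction l as [|i l IH]; intro Hl; simpl; [lra|].
    destruct IH as [I1 I2]; [intros; apply Hl; now right|].
    pose proof (Hl i (or_introl eq_refl)). split.
    - eapply Rle_trans; [exact I1|apply Rmax_r].
    - now apply Rmax_lub. }
  apply G. intros i Hi. apply in_seq in Hi. apply H. lia.
Qed.

Theorem theorem7
  (r : nat -> R)
  (hr0 : r 0%nat = 0)
  (hinc : forall n, r n < r (S n))
  (hinf : cv_infty r)
  (hdiv : cv_infty (fun n => sum_f_R0 (fun i => / r (S i)) n))
  (a : R) (ha0 : 0 < a) (ha1 : a < 1)
  (k : nat) (hk : (1 <= k)%nat)
  (B : nat -> nat -> R -> R)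
  (hB : forall m, is_CB_basis r m a 1 (B m))
  (eta1 etak : nat -> nat -> R)
  (heta1 : forall m, (1 <= m)%nat ->
     is_control_points m (B m) (fun t => Rpower t (r 1%nat)) (eta1 m))
  (hetak : forall m, (k <= m)%nat ->
     is_control_points m (B m) (fun t => Rpower t (r k)) (etak m)) :
  Un_cv (fun m => max_upto m (fun i =>
           Rabs (Rpower (eta1 m i) (r k / r 1%nat) - etak m i))) 0.
Proof.
  intros eps Heps.
  (* Half of [eps], because the bound on the maximum is not strict. *)
  destruct (node_prod_asymptotic r hr0 hinc hinf hdiv k hk (eps / 2) ltac:(lra)) as (N & HN).
  exists (N + k)%nat. intros m Hm.
  assert (HA : 0 < - ln a).
  { pose proof (ln_increasing a 1 ha0 ha1). rewrite ln_1 in *. lra. }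
  assert (H1 := positive_node r hr0 hinc 1 ltac:(lia)).
  destruct (finite_choice ((R -> R) * (R -> R)) (fun _ => 0, fun _ => 0)
    (fun j t => normalized_pair r m (- ln a) (S m) (S j) (fst t) (snd t)) m) as (pq & Hpq).
  { intros j Hj.
    destruct (normalized_pair_exists r hinc m (- ln a) HA (S m) (S j) ltac:(lia) ltac:(lia))
      as (p & q & H). now exists (p, q). }
  assert (Val : forall i l lam, (i <= m)%nat -> (l <= m)%nat ->
            is_control_points m (B m) (fun t => Rpower t (r l)) lam -> lam i = snd (pq i) (r l)).
  { intros i l lam Hi Hl. now apply (control_point_normalized r hr0 m a ha0 (B m) (hB m) i (fst (pq i))), Hpq. }
  assert (Hb : forall s, 0 <= s <= - ln a -> exists b, forall l, (l <= m)%nat ->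
     exp (- s * r l) = sum_f_R0 (fun j => b j * snd (pq j) (r l)) m).
  (* Evaluating the expansions of the powers at t = exp (- s) makes the basis values the
     coefficients. *)
  { intros s _. exists (fun j => B m j (exp (- s))). intros l Hl.
    destruct (hB m) as (_ & _ & Hspan & _ & _).
    destruct (Hspan (fun t => Rpower t (r l))) as (lam & Hlam).
    - exists (fun j => if Nat.eq_dec j l then 1 else 0). intros t Ht.
      rewrite (sum_f_R0_single _ m l Hl).
      + destruct (Nat.eq_dec l l); [ring|contradiction].
      + intros j _ Hj. destruct (Nat.eq_dec j l); [contradiction|ring].
    - assert (HP : is_control_points m (B m) (fun t => Rpower t (r l)) lam).
      { intros t Ht. rewrite (Hlam t Ht). apply sum_eq. intros; ring. }
      rewrite (sum_eq _ (fun j => B m j (exp (- s)) * lam j)).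
      + rewrite <- (HP (exp (- s)) (exp_pos _)). unfold Rpower. rewrite ln_exp.
        f_equal. ring.
      + intros j Hj. now rewrite (Val j l lam Hj Hl HP). }
  assert (Main : forall i, (i <= m)%nat ->
            Rabs (Rpower (eta1 m i) (r k / r 1%nat) - etak m i) <= eps / 2).
  { intros i Hi.
    rewrite (Val i 1%nat (eta1 m)), (Val i k (etak m)); try lia;
      [|apply hetak; lia|apply heta1; lia].
    destruct (control_point_upper r hr0 hinc m (- ln a) HA k ltac:(lia) _ _ Hpq Hb i Hi)
      as (s & E1 & U).
    destruct (Hpq i Hi) as (_ & _ & _ & _ & _ & C & E0).
    rewrite Nat.sub_diag, hr0 in E0.
    pose proof (node_cone_jensen r hr0 hinc m k s (eps / 2) _ ltac:(lia)
      (fun d => HN m d ltac:(lia)) C) as L.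
    rewrite E0, E1 in L.
    (* With eta_i (t^(r_1)) = exp (- s r_1), the power is exp (- s r_k), and both bounds compare
       eta_i (t^(r_k)) with this number. *)
    assert (EP : Rpower (snd (pq i) (r 1%nat)) (r k / r 1%nat) = exp (- s * r k)).
    { rewrite E1. unfold Rpower. rewrite ln_exp. f_equal. field. lra. }
    rewrite EP. apply Rabs_le. lra. }
  destruct (max_upto_bound m (fun i => Rabs (Rpower (eta1 m i) (r k / r 1%nat) - etak m i))
    (eps / 2) ltac:(lra) Main) as [M0 M1].
  unfold Rdist. rewrite Rminus_0_r, Rabs_right; lra.
Qed.
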